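(* Let $A\in\mathbb C$, $C,\omega\in\mathbb R$, let $l_1\ge 1$ and $m_1\neq 0$ be integers with $|m_1|\le l_1$, and let $$\Psi(\lambda,\mu,t)=A\,Y_{l_1m_1}(\lambda-\omega t,\mu)-C\mu .$$ Then, at every time $t$, the following hold for all integers $l_2\ge1$ and $m_2$ with $0\le|m_2|\le l_2$. 1. $$MC(\nabla^\perp\Psi,e_{l_2m_2})=|A|^2\,MC(e_{l_1m_1},e_{l_2m_2})+C^2m_2^2\,(2-l_2(l_2+1)).$$ 2. For all $a,b\in\mathbb R$, $$\widehat{MC}\big((\nabla^\perp\Psi,a),(e_{l_2m_2},b)\big)=|A|^2MC(e_{l_1m_1},e_{l_2m_2})+C^2m_2^2(2-l_2(l_2+1))-|A|^2m_1^2\,\delta^{l_1}_{l_2}\delta^{m_1}_{m_2}-a\,m_2^2\,C .$$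
   Context: Use coordinates $(\lambda,\mu)\in(0,2\pi)\times(-1,1)$ on the unit sphere $\mathbb S^2$ ($\lambda$ longitude, $\mu$ height), with area element $d\lambda\,d\mu$ and Laplace–Beltrami operator $\Delta$. The Poisson bracket is $\{f,g\}=\partial_\lambda f\,\partial_\mu g-\partial_\mu f\,\partial_\lambda g$, extended complex-bilinearly to complex-valued functions, and $\langle f,g\rangle=\int_{\mathbb S^2} f\,g^*\,d\lambda\,d\mu$, where $^*$ is complex conjugation. For integers $l\ge 0$, $|m|\le l$, $Y_{lm}$ denotes the complex spherical harmonic: for $m\ge 0$, $Y_{lm}=(-1)^m\sqrt{\frac{2l+1}{4\pi}\frac{(l-m)!}{(l+m)!}}\,P_l^m(\mu)e^{im\lambda}$ with $P_l^m(\mu)=\frac{(1-\mu^2)^{m/2}}{2^l l!}\frac{d^{l+m}}{d\mu^{l+m}}(\mu^2-1)^l$, and $Y_{l\,-m}=(-1)^mY_{lm}^*$. These are orthonormal with $\Delta Y_{lm}=-l(l+1)Y_{lm}$. Put $\nabla^\perp f=(-\partial_\mu f,\partial_\lambda f)$ and $e_{lm}=\nabla^\perp Y_{lm}$. For $u=\nabla^\perp f$, $v=\nabla^\perp g$ and $a,b\in\mathbb R$, the Misiolek criteria without and with Coriolis force are $$MC(u,v)=\langle\Delta\{f,g\},\{f,g\}\rangle-\langle\{\Delta f,g\},\{f,g\}\rangle,$$ $$\widehat{MC}((u,a),(v,b))=MC(u,v)-|\langle\{\mu,f\},g\rangle|^2-a\,\langle\{\mu,\{f,g\}\},g\rangle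 .$$ $\Psi$ is a (complex) Rossby–Haurwitz wave; it solves the quasi-geostrophic equation $\partial_t(\Delta f-\alpha^2f)+\{f,\Delta f-a\mu\}=0$ when $\omega l_1(l_1+1)+\omega\alpha^2=l_1(l_1+1)C-2C+a$. $\delta$ is the Kronecker delta. For time-dependent $\Psi$ the criteria are evaluated at each fixed $t$. *)

(* Defs.v *)
From Stdlib Require Import Reals ZArith ClassicalEpsilon.
From Coquelicot Require Import Coquelicot.
Open Scope R_scope.

(* Complex scalar fields and vector fields on the sphere, written in the
   coordinates (lambda, mu).  Values outside (0, 2 PI) x (-1, 1) never matter:
   the integrals below only see the open coordinate rectangle. *)
Definition scalar_field := R -> R -> C.
Definition vector_field := R -> R -> C * C.

Definition CDerive (f : R -> C) (x : R) : C :=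
  (Derive (fun y => Re (f y)) x, Derive (fun y => Im (f y)) x).

Definition ex_Cderive (f : R -> C) (x : R) : Prop :=
  ex_derive (fun y => Re (f y)) x /\ ex_derive (fun y => Im (f y)) x.

Definition CInt (f : R -> C) (a b : R) : C :=
  (RInt (fun y => Re (f y)) a b, RInt (fun y => Im (f y)) a b).

Definition d_lambda (f : scalar_field) : scalar_field :=
  fun lam mu => CDerive (fun x => f x mu) lam.

Definition d_mu (f : scalar_field) : scalar_field :=
  fun lam mu => CDerive (fun y => f lam y) mu.

(* The round metric is (1 - mu^2) dlambda^2 + dmu^2 / (1 - mu^2), with area
   element dlambda dmu; this is its Laplace-Beltrami operator. *)
Definition Laplacian (f : scalar_field) : scalar_field :=
  fun lam mu =>
    (d_mu (fun x y => RtoC (1 - y ^ 2) * d_mu f x y) lam mu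
     + RtoC (/ (1 - mu ^ 2)) * d_lambda (d_lambda f) lam mu)%C.

Definition bracket (f g : scalar_field) : scalar_field :=
  fun lam mu =>
    (d_lambda f lam mu * d_mu g lam mu - d_mu f lam mu * d_lambda g lam mu)%C.

Definition inner (f g : scalar_field) : C :=
  CInt (fun mu =>
    CInt (fun lam => (f lam mu * Cconj (g lam mu))%C) 0 (2 * PI)) (-1) 1.

Definition nabla_perp (f : scalar_field) : vector_field :=
  fun lam mu => ((- d_mu f lam mu)%C, d_lambda f lam mu).

Definition is_stream (u : vector_field) (f : scalar_field) : Prop :=
  forall lam mu, 0 < lam < 2 * PI -> -1 < mu < 1 ->
    ex_Cderive (fun x => f x mu) lam /\ ex_Cderive (fun y => f lam y) mu /\
    u lam mu = nabla_perp f lam mu.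

(* The stream function of a field is unique up to an additive constant on the
   connected rectangle (0, 2 PI) x (-1, 1), and the criteria below do not
   depend on that constant. *)
Definition stream (u : vector_field) : scalar_field :=
  epsilon (inhabits (fun _ _ => RtoC 0)) (is_stream u).

Definition mu_field : scalar_field := fun _ mu => RtoC mu.

Definition MC (u v : vector_field) : C :=
  let f := stream u in
  let g := stream v in
  (inner (Laplacian (bracket f g)) (bracket f g)
   - inner (bracket (Laplacian f) g) (bracket f g))%C.

(* The criterion with Coriolis force; the coefficient of [v] does not occur in
   the formula. *)
Definition MC_hat (U V : vector_field * R) : C :=
  let (u, a) := U in
  let (v, _) := V in
  let f := stream u in
  let g := stream v in
  (MC u v - RtoC (Cmod (inner (bracket mu_field f) g) ^ 2)
   - RtoC a * inner (bracket mu_field (bracket f g)) g)%C.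

(* No Condon-Shortley sign here: it is put in [Y_nonneg]. *)
Definition Legendre (l m : nat) (mu : R) : R :=
  sqrt (1 - mu ^ 2) ^ m / (2 ^ l * INR (fact l))
  * Derive_n (fun x => (x ^ 2 - 1) ^ l) (l + m) mu.

Definition cis (x : R) : C := (cos x, sin x).

Definition Y_nonneg (l m : nat) : scalar_field :=
  fun lam mu =>
    (RtoC ((-1) ^ m
           * sqrt ((2 * INR l + 1) / (4 * PI)
                   * (INR (fact (l - m)) / INR (fact (l + m))))
           * Legendre l m mu)
     * cis (INR m * lam))%C.

(* Only meaningful for |m| <= l. *)
Definition Y (l : nat) (m : Z) : scalar_field :=
  fun lam mu =>
    if Z.leb 0 m then Y_nonneg l (Z.to_nat m) lam mu
    else (RtoC ((-1) ^ Z.abs_nat m) * Cconj (Y_nonneg l (Z.abs_nat m) lam mu))%C.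

Definition e (l : nat) (m : Z) : vector_field := nabla_perp (Y l m).

Definition RH_wave (A : C) (c omega : R) (l1 : nat) (m1 : Z) (t : R)
  : scalar_field :=
  fun lam mu => (A * Y l1 m1 (lam - omega * t)%R mu - RtoC (c * mu))%C.

Definition delta (i j : Z) : R := if Z.eqb i j then 1 else 0.

(* Main.v *)
Require Import Defs.
From Stdlib Require Import Reals ZArith.
From Coquelicot Require Import Coquelicot.
From Stdlib Require Import Lra Lia FunctionalExtensionality ClassicalEpsilon.
Open Scope R_scope.

(* In longitude everything is a pure frequency. The bracket of the wave with
   Y_(l2,m2) is a term of frequency m1 + m2, proportional to A, plus a multiple
   c m2 of Y_(l2,m2) coming from the zonal flow. As m1 <> 0 these are orthogonal,
   so the criterion splits; the constants follow from the eigenvalue -l(l+1) of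
   the spherical harmonics, from Laplacian mu = -2 mu, and from orthonormality.

   Splitting integrals requires that the Laplacian of the bracket be bounded near
   the poles. In coordinates this holds because the bracket of two fields
   (1 - mu^2)^(|k|/2) P(mu) e^(i k lambda), P polynomial, is again of this form.

   A stream function is determined only up to an additive constant; the constant
   enters the Coriolis terms undifferentiated, paired with a lambda-derivative,
   and so integrates to zero. *)

(** * Separated fields *)

(** The value of [MC (e l1 m1) (e l2 m2)] is never computed: a spherical harmonic is a [wave]
    without zonal part, so the single formula [MC_wave] evaluates both sides in terms of the same
    [wave_energy]. Time enters only through a phase of modulus one in the amplitude.

    On the Y_(l2,m2) component of the bracket, [Laplacian] acts by -l2(l2+1), whereas replacing the
    wave by its Laplacian acts by -2; the difference is the factor 2 - l2(l2+1). The bracket with mu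
    is minus the longitude derivative: it kills the zonal flow, so the squared Coriolis term sees
    only the harmonic part of the wave and yields the two Kronecker deltas.

    The eigenvalue equation comes from Rodrigues' formula, by differentiating repeatedly a
    first-order equation for (x^2 - 1)^l. *)

Definition sep (z : C) (k : Z) (p : R -> R) : scalar_field :=
  fun lam mu => (z * RtoC (p mu) * cis (IZR k * lam))%C.

Definition fadd (F G : scalar_field) : scalar_field :=
  fun lam mu => (F lam mu + G lam mu)%C.

Definition eq_rect (F G : scalar_field) : Prop :=
  forall lam mu, 0 < lam < 2 * PI -> -1 < mu < 1 -> F lam mu = G lam mu.

Lemma eq_rect_trans F G H : eq_rect F G -> eq_rect G H -> eq_rect F H.
Proof. intros h1 h2 lam mu hl hm. now rewrite h1, h2. Qed.

Lemma locally_open_interval (a b x : R) (P : R -> Prop) :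
  a < x < b -> (forall y, a < y < b -> P y) -> locally x P.
Proof.
  intros hx hP.
  apply (locally_interval P x a b); simpl; try tauto.
  intros y h1 h2. apply hP. simpl in *. lra.
Qed.

Lemma d_lambda_ext F G : eq_rect F G -> eq_rect (d_lambda F) (d_lambda G).
Proof.
  intros h lam mu hl hm. unfold d_lambda, CDerive.
  f_equal; apply Derive_ext_loc, (locally_open_interval _ _ _ _ hl);
    intros y hy; now rewrite h.
Qed.

Lemma d_mu_ext F G : eq_rect F G -> eq_rect (d_mu F) (d_mu G).
Proof.
  intros h lam mu hl hm. unfold d_mu, CDerive.
  f_equal; apply Derive_ext_loc, (locally_open_interval _ _ _ _ hm);
    intros y hy; now rewrite h.
Qed.

(** Stated for gradients because that is all that is known of a stream function; the Laplacian sees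
    its argument only through first derivatives. *)
Lemma Laplacian_ext_grad F G :
  eq_rect (d_lambda F) (d_lambda G) -> eq_rect (d_mu F) (d_mu G) ->
  eq_rect (Laplacian F) (Laplacian G).
Proof.
  intros h1 h2 lam mu hl hm. unfold Laplacian.
  rewrite (d_lambda_ext _ _ h1 lam mu hl hm).
  rewrite (d_mu_ext (fun x y => RtoC (1 - y ^ 2) * d_mu F x y)%C
                    (fun x y => RtoC (1 - y ^ 2) * d_mu G x y)%C); trivial.
  intros x y hx hy. now rewrite h2.
Qed.

Lemma Laplacian_ext F G : eq_rect F G -> eq_rect (Laplacian F) (Laplacian G).
Proof. intros h. apply Laplacian_ext_grad; auto using d_lambda_ext, d_mu_ext. Qed.

Lemma bracket_ext_grad F F' G G' :
  eq_rect (d_lambda F) (d_lambda F') -> eq_rect (d_mu F) (d_mu F') ->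
  eq_rect (d_lambda G) (d_lambda G') -> eq_rect (d_mu G) (d_mu G') ->
  eq_rect (bracket F G) (bracket F' G').
Proof.
  intros h1 h2 h3 h4 lam mu hl hm. unfold bracket.
  now rewrite h1, h2, h3, h4.
Qed.

Lemma bracket_ext F F' G G' :
  eq_rect F F' -> eq_rect G G' -> eq_rect (bracket F G) (bracket F' G').
Proof. intros. apply bracket_ext_grad; auto using d_lambda_ext, d_mu_ext. Qed.

Definition differentiable (p : R -> R) : Prop :=
  forall x, -1 < x < 1 -> ex_derive p x.

Lemma Re_sep z k p lam mu :
  Re (sep z k p lam mu)
  = (fst z * cos (IZR k * lam) - snd z * sin (IZR k * lam)) * p mu.
Proof. unfold sep, cis; destruct z; simpl; ring. Qed.

Lemma Im_sep z k p lam mu :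
  Im (sep z k p lam mu)
  = (fst z * sin (IZR k * lam) + snd z * cos (IZR k * lam)) * p mu.
Proof. unfold sep, cis; destruct z; simpl; ring. Qed.

(** [Derive] commutes with scaling even where it takes its default value, so this is an equality of
    fields for every [p]. Sums do not have this property; hence the differentiability conditions in
    the [fadd] lemmas. *)
Lemma d_mu_sep z k p : d_mu (sep z k p) = sep z k (Derive p).
Proof.
  apply functional_extensionality; intro lam.
  apply functional_extensionality; intro mu.
  unfold d_mu, CDerive. apply injective_projections.
  - cbn [fst]. change (fst (sep z k (Derive p) lam mu)) with (Re (sep z k (Derive p) lam mu)).
    rewrite Re_sep, <- Derive_scal. apply Derive_ext. intro; apply Re_sep.
  - cbn [snd]. change (snd (sep z k (Derive p) lam mu)) with (Im (sep z k (Derive p) lam mu)).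
    rewrite Im_sep, <- Derive_scal. apply Derive_ext. intro; apply Im_sep.
Qed.

Lemma is_derive_Re_sep z k p lam mu :
  is_derive (fun x => Re (sep z k p x mu)) lam
    (Re (sep (Ci * RtoC (IZR k) * z)%C k p lam mu)).
Proof.
  eapply is_derive_ext; [intro; symmetry; apply Re_sep|].
  rewrite Re_sep. auto_derive; trivial. destruct z; simpl; ring.
Qed.

Lemma is_derive_Im_sep z k p lam mu :
  is_derive (fun x => Im (sep z k p x mu)) lam
    (Im (sep (Ci * RtoC (IZR k) * z)%C k p lam mu)).
Proof.
  eapply is_derive_ext; [intro; symmetry; apply Im_sep|].
  rewrite Im_sep. auto_derive; trivial. destruct z; simpl; ring.
Qed.

Lemma d_lambda_sep z k p :
  d_lambda (sep z k p) = sep (Ci * RtoC (IZR k) * z)%C k p.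
Proof.
  apply functional_extensionality; intro lam.
  apply functional_extensionality; intro mu.
  unfold d_lambda, CDerive. apply injective_projections; apply is_derive_unique.
  - apply is_derive_Re_sep.
  - apply is_derive_Im_sep.
Qed.

Definition differentiable_field (F : scalar_field) : Prop :=
  forall lam mu, 0 < lam < 2 * PI -> -1 < mu < 1 ->
    ex_Cderive (fun x => F x mu) lam /\ ex_Cderive (fun y => F lam y) mu.

Lemma differentiable_sep z k p :
  differentiable p -> differentiable_field (sep z k p).
Proof.
  intros hp lam mu hl hm. split; split.
  - eexists; apply is_derive_Re_sep.
  - eexists; apply is_derive_Im_sep.
  - eapply ex_derive_ext; [intro; symmetry; apply Re_sep|].
    apply ex_derive_scal, hp, hm.
  - eapply ex_derive_ext; [intro; symmetry; apply Im_sep|].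
    apply ex_derive_scal, hp, hm.
Qed.

Lemma differentiable_fadd F G :
  differentiable_field F -> differentiable_field G ->
  differentiable_field (fadd F G).
Proof.
  intros hF hG lam mu hl hm.
  destruct (hF lam mu hl hm) as [[? ?] [? ?]], (hG lam mu hl hm) as [[? ?] [? ?]].
  split; split; apply (@ex_derive_plus R_AbsRing R_NormedModule); assumption.
Qed.

Lemma d_lambda_fadd F G :
  differentiable_field F -> differentiable_field G ->
  eq_rect (d_lambda (fadd F G)) (fadd (d_lambda F) (d_lambda G)).
Proof.
  intros hF hG lam mu hl hm.
  destruct (hF lam mu hl hm) as [[? ?] _], (hG lam mu hl hm) as [[? ?] _].
  apply injective_projections; apply Derive_plus; assumption.
Qed.

Lemma d_mu_fadd F G :
  differentiable_field F -> differentiable_field G ->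
  eq_rect (d_mu (fadd F G)) (fadd (d_mu F) (d_mu G)).
Proof.
  intros hF hG lam mu hl hm.
  destruct (hF lam mu hl hm) as [_ [? ?]], (hG lam mu hl hm) as [_ [? ?]].
  apply injective_projections; apply Derive_plus; assumption.
Qed.

Lemma bracket_fadd_l F1 F2 G :
  differentiable_field F1 -> differentiable_field F2 ->
  eq_rect (bracket (fadd F1 F2) G) (fadd (bracket F1 G) (bracket F2 G)).
Proof.
  intros h1 h2 lam mu hl hm. unfold bracket.
  rewrite d_lambda_fadd, d_mu_fadd by assumption. unfold fadd. ring.
Qed.

Lemma bracket_fadd_r F G1 G2 :
  differentiable_field G1 -> differentiable_field G2 ->
  eq_rect (bracket F (fadd G1 G2)) (fadd (bracket F G1) (bracket F G2)).
Proof.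
  intros h1 h2 lam mu hl hm. unfold bracket.
  rewrite d_lambda_fadd, d_mu_fadd by assumption. unfold fadd. ring.
Qed.

Lemma cis_plus x y : cis (x + y) = (cis x * cis y)%C.
Proof. unfold cis. rewrite cos_plus, sin_plus. apply injective_projections; simpl; ring. Qed.

Definition wronskian (k1 : Z) (p1 : R -> R) (k2 : Z) (p2 : R -> R) : R -> R :=
  fun x => IZR k1 * p1 x * Derive p2 x - IZR k2 * Derive p1 x * p2 x.

Lemma bracket_sep z1 k1 p1 z2 k2 p2 :
  bracket (sep z1 k1 p1) (sep z2 k2 p2)
  = sep (Ci * z1 * z2)%C (k1 + k2) (wronskian k1 p1 k2 p2).
Proof.
  apply functional_extensionality; intro lam.
  apply functional_extensionality; intro mu.
  unfold bracket. rewrite !d_lambda_sep, !d_mu_sep. unfold sep, wronskian.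
  rewrite plus_IZR, Rmult_plus_distr_r, cis_plus, RtoC_minus, !RtoC_mult. ring.
Qed.

(** The associated Legendre operator of order k. *)
Definition radial_Laplacian (k : Z) (p : R -> R) : R -> R :=
  fun x => Derive (fun y => (1 - y ^ 2) * Derive p y) x - IZR k ^ 2 / (1 - x ^ 2) * p x.

Lemma Laplacian_sep z k p :
  Laplacian (sep z k p) = sep z k (radial_Laplacian k p).
Proof.
  apply functional_extensionality; intro lam.
  apply functional_extensionality; intro mu.
  unfold Laplacian. rewrite !d_lambda_sep, d_mu_sep.
  replace (fun x y => RtoC (1 - y ^ 2) * sep z k (Derive p) x y)%C
    with (sep z k (fun y => (1 - y ^ 2) * Derive p y)).
  2: { apply functional_extensionality; intro x.
       apply functional_extensionality; intro y.
       unfold sep. rewrite RtoC_mult. ring. }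
  rewrite d_mu_sep. unfold sep, radial_Laplacian.
  rewrite RtoC_minus, RtoC_mult. unfold Rdiv. rewrite RtoC_mult, RtoC_pow.
  replace (RtoC (IZR k) ^ 2)%C with (RtoC (IZR k) * RtoC (IZR k))%C by (simpl; ring).
  replace (Ci * RtoC (IZR k) * (Ci * RtoC (IZR k) * z))%C
    with (- (RtoC (IZR k) * RtoC (IZR k)) * z)%C.
  - ring.
  - apply injective_projections; simpl; ring.
Qed.

(** The latitude part differentiates twice, so additivity needs both the profiles and their fluxes
    (1 - y^2) p' to be differentiable. *)
Lemma Laplacian_fadd_sep z1 k1 p1 z2 k2 p2 :
  differentiable p1 -> differentiable (fun y => (1 - y ^ 2) * Derive p1 y) ->
  differentiable p2 -> differentiable (fun y => (1 - y ^ 2) * Derive p2 y) ->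
  eq_rect (Laplacian (fadd (sep z1 k1 p1) (sep z2 k2 p2)))
    (fadd (sep z1 k1 (radial_Laplacian k1 p1)) (sep z2 k2 (radial_Laplacian k2 p2))).
Proof.
  intros d1 d1' d2 d2'. rewrite <- !Laplacian_sep.
  intros lam mu hl hm. unfold Laplacian, fadd at 3.
  rewrite (d_lambda_ext _ _ (d_lambda_fadd _ _ (differentiable_sep z1 k1 p1 d1)
    (differentiable_sep z2 k2 p2 d2)) lam mu hl hm).
  rewrite (d_lambda_fadd (d_lambda (sep z1 k1 p1))); trivial;
    try (rewrite d_lambda_sep; now apply differentiable_sep).
  assert (E : forall z k p, (fun x y => RtoC (1 - y ^ 2) * d_mu (sep z k p) x y)%C
    = sep z k (fun y => (1 - y ^ 2) * Derive p y)).
  { intros. apply functional_extensionality; intro x.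
    apply functional_extensionality; intro y.
    rewrite d_mu_sep. unfold sep. rewrite RtoC_mult. ring. }
  rewrite (d_mu_ext _ (fadd (fun x y => RtoC (1 - y ^ 2) * d_mu (sep z1 k1 p1) x y)%C
     (fun x y => RtoC (1 - y ^ 2) * d_mu (sep z2 k2 p2) x y)%C)); trivial.
  - rewrite !E, d_mu_fadd by (trivial; now apply differentiable_sep).
    unfold fadd. ring.
  - intros x y hx hy. rewrite d_mu_fadd by (trivial; now apply differentiable_sep).
    unfold fadd. ring.
Qed.

(** * Inner products *)

Definition is_CInt (f : R -> C) (a b : R) (v : C) : Prop :=
  is_RInt (fun y => Re (f y)) a b (Re v) /\ is_RInt (fun y => Im (f y)) a b (Im v).

Lemma is_CInt_unique f a b v : is_CInt f a b v -> CInt f a b = v.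
Proof.
  intros [h1 h2]. apply injective_projections; apply is_RInt_unique; assumption.
Qed.

Lemma is_CInt_plus f g a b v w :
  is_CInt f a b v -> is_CInt g a b w ->
  is_CInt (fun x => (f x + g x)%C) a b (v + w)%C.
Proof.
  intros [? ?] [? ?].
  split; apply (@is_RInt_plus R_NormedModule); assumption.
Qed.

Lemma is_CInt_ext f g a b v :
  a <= b -> (forall x, a < x < b -> f x = g x) -> is_CInt f a b v -> is_CInt g a b v.
Proof.
  intros hab h [h1 h2].
  split; [apply (is_RInt_ext (fun y => Re (f y)))|apply (is_RInt_ext (fun y => Im (f y)))];
    trivial; intros x; rewrite Rmin_left, Rmax_right by lra; intro; now rewrite h.
Qed.

Lemma is_CInt_scal (z : C) f a b v :
  is_RInt f a b v -> is_CInt (fun x => (z * RtoC (f x))%C) a b (z * RtoC v)%C.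
Proof.
  intros h. destruct z as [z1 z2].
  split; simpl.
  - replace (z1 * v - z2 * 0) with (scal z1 v) by (unfold scal; simpl; unfold mult; simpl; ring).
    eapply is_RInt_ext; [|apply is_RInt_scal, h].
    intros x _. unfold scal; simpl; unfold mult; simpl; ring.
  - replace (z1 * 0 + z2 * v) with (scal z2 v) by (unfold scal; simpl; unfold mult; simpl; ring).
    eapply is_RInt_ext; [|apply is_RInt_scal, h].
    intros x _. unfold scal; simpl; unfold mult; simpl; ring.
Qed.

(* A relational version of [inner]: it keeps track of integrability, so that
   sums can be integrated termwise despite the junk values of [RInt]. *)
Definition is_inner (F G : scalar_field) (v : C) : Prop :=
  exists h : R -> C,
    (forall mu, -1 < mu < 1 ->
       is_CInt (fun lam => (F lam mu * Cconj (G lam mu))%C) 0 (2 * PI) (h mu))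
    /\ is_CInt h (-1) 1 v.

Lemma two_PI_nonneg : 0 <= 2 * PI.
Proof. generalize PI_RGT_0; lra. Qed.

Lemma is_inner_unique F G v : is_inner F G v -> inner F G = v.
Proof.
  intros [h [h1 h2]]. unfold inner. apply is_CInt_unique.
  apply is_CInt_ext with (3 := h2); [lra|].
  intros x hx. symmetry. now apply is_CInt_unique, h1.
Qed.

Lemma is_inner_ext F F' G G' v :
  eq_rect F' F -> eq_rect G' G -> is_inner F G v -> is_inner F' G' v.
Proof.
  intros hF hG [h [h1 h2]]. exists h. split; trivial.
  intros mu hm. apply is_CInt_ext with (3 := h1 mu hm); [apply two_PI_nonneg|].
  intros x hx. now rewrite hF, hG.
Qed.

Lemma is_inner_fadd_l F1 F2 G v1 v2 :
  is_inner F1 G v1 -> is_inner F2 G v2 -> is_inner (fadd F1 F2) G (v1 + v2)%C.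
Proof.
  intros [h [h1 h2]] [h' [h1' h2']]. exists (fun x => (h x + h' x)%C). split.
  - intros mu hm. apply is_CInt_ext with (3 := is_CInt_plus _ _ _ _ _ _ (h1 mu hm) (h1' mu hm));
      [apply two_PI_nonneg|].
    intros x hx. unfold fadd. ring.
  - now apply is_CInt_plus.
Qed.

Lemma is_inner_fadd_r F G1 G2 v1 v2 :
  is_inner F G1 v1 -> is_inner F G2 v2 -> is_inner F (fadd G1 G2) (v1 + v2)%C.
Proof.
  intros [h [h1 h2]] [h' [h1' h2']]. exists (fun x => (h x + h' x)%C). split.
  - intros mu hm. apply is_CInt_ext with (3 := is_CInt_plus _ _ _ _ _ _ (h1 mu hm) (h1' mu hm));
      [apply two_PI_nonneg|].
    intros x hx. unfold fadd. rewrite Cplus_conj. ring.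
  - now apply is_CInt_plus.
Qed.

Definition circle_integral (n : Z) : R := if Z.eqb n 0 then 2 * PI else 0.

Lemma is_RInt_const_R (a b c v : R) : v = (b - a) * c -> is_RInt (fun _ => c) a b v.
Proof. intros ->. exact (@is_RInt_const R_NormedModule a b c). Qed.

Lemma is_RInt_cos_sin n :
  is_RInt (fun x => cos (IZR n * x)) 0 (2 * PI) (circle_integral n) /\
  is_RInt (fun x => sin (IZR n * x)) 0 (2 * PI) 0.
Proof.
  unfold circle_integral. destruct (Z.eqb_spec n 0) as [->|hn].
  - split.
    + apply (is_RInt_ext (fun _ => 1)).
      { intros. now rewrite Rmult_0_l, cos_0. }
      apply is_RInt_const_R; ring.
    + apply (is_RInt_ext (fun _ => 0)).
      { intros. now rewrite Rmult_0_l, sin_0. }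
      apply is_RInt_const_R; ring.
  - assert (hn' : IZR n <> 0) by now apply not_0_IZR.
    assert (hs : sin (IZR n * PI) = 0) by (apply sin_eq_0_1; now exists n).
    assert (hs2 : sin (IZR n * (2 * PI)) = 0).
    { replace (IZR n * (2 * PI)) with (2 * (IZR n * PI)) by ring.
      rewrite sin_2a, hs. ring. }
    assert (hc2 : cos (IZR n * (2 * PI)) = 1).
    { replace (IZR n * (2 * PI)) with (2 * (IZR n * PI)) by ring.
      rewrite cos_2a_sin, hs. ring. }
    split.
    + replace 0 with (minus (/ IZR n * sin (IZR n * (2 * PI))) (/ IZR n * sin (IZR n * 0))) at 2.
      2: { rewrite hs2, !Rmult_0_r, sin_0. unfold minus, plus, opp; simpl. ring. }
      apply (is_RInt_derive (fun x => / IZR n * sin (IZR n * x))).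
      * intros. auto_derive; trivial. field; trivial.
      * intros. apply (@ex_derive_continuous R_AbsRing R_NormedModule). auto_derive; trivial.
    + replace 0 with (minus (- / IZR n * cos (IZR n * (2 * PI))) (- / IZR n * cos (IZR n * 0))) at 2.
      2: { rewrite hc2, Rmult_0_r, cos_0. unfold minus, plus, opp; simpl. ring. }
      apply (is_RInt_derive (fun x => - / IZR n * cos (IZR n * x))).
      * intros. auto_derive; trivial. field; trivial.
      * intros. apply (@ex_derive_continuous R_AbsRing R_NormedModule). auto_derive; trivial.
Qed.

Lemma is_CInt_cis (z : C) n :
  is_CInt (fun x => (z * cis (IZR n * x))%C) 0 (2 * PI) (z * RtoC (circle_integral n))%C.
Proof.
  destruct (is_RInt_cos_sin n) as [hc hs].
  apply is_CInt_ext with (f := fun x => (z * RtoC (cos (IZR n * x))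
     + (z * Ci) * RtoC (sin (IZR n * x)))%C).
  - apply two_PI_nonneg.
  - intros x _. unfold cis. apply injective_projections; simpl; ring.
  - replace (z * RtoC (circle_integral n))%C
      with (z * RtoC (circle_integral n) + z * Ci * RtoC 0)%C by ring.
    apply is_CInt_plus; now apply is_CInt_scal.
Qed.

(* The values outside (-1, 1) are junk; the poles are removable singularities. *)
Definition regular (p : R -> R) : Prop :=
  exists P : R -> R, (forall x, continuous P x) /\ (forall x, -1 < x < 1 -> p x = P x).

Lemma regular_mult p q : regular p -> regular q -> regular (fun x => p x * q x).
Proof.
  intros [P [hP1 hP2]] [Q [hQ1 hQ2]]. exists (fun x => P x * Q x). split.
  - intro x. apply (@continuous_mult R_UniformSpace R_AbsRing); auto.
  - intros x hx. now rewrite hP2, hQ2.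
Qed.

Lemma regular_ex_RInt p : regular p -> ex_RInt p (-1) 1.
Proof.
  intros [P [hP1 hP2]]. apply (ex_RInt_ext P).
  - intros x. rewrite Rmin_left, Rmax_right by lra. intro; symmetry; auto.
  - apply (@ex_RInt_continuous R_CompleteNormedModule). auto.
Qed.

Lemma is_inner_sep z1 k1 p1 z2 k2 p2 :
  regular p1 -> regular p2 ->
  is_inner (sep z1 k1 p1) (sep z2 k2 p2)
    (z1 * Cconj z2 * RtoC (circle_integral (k1 - k2) * RInt (fun x => p1 x * p2 x)%R (-1) 1))%C.
Proof.
  intros r1 r2.
  exists (fun x => z1 * Cconj z2 * RtoC (circle_integral (k1 - k2)) * RtoC (p1 x * p2 x))%C.
  split.
  - intros mu hm.
    replace (z1 * Cconj z2 * RtoC (circle_integral (k1 - k2)) * RtoC (p1 mu * p2 mu))%C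
      with ((z1 * Cconj z2 * RtoC (p1 mu * p2 mu)) * RtoC (circle_integral (k1 - k2)))%C by ring.
    apply is_CInt_ext with (3 := is_CInt_cis _ _); [apply two_PI_nonneg|].
    intros x _. unfold sep. rewrite minus_IZR.
    replace ((IZR k1 - IZR k2) * x) with (IZR k1 * x + - (IZR k2 * x)) by ring.
    rewrite cis_plus, !Cmult_conj, RtoC_mult.
    replace (cis (- (IZR k2 * x))) with (Cconj (cis (IZR k2 * x))).
    2: { unfold cis. rewrite cos_neg, sin_neg. reflexivity. }
    replace (Cconj (RtoC (p2 mu))) with (RtoC (p2 mu))
      by (apply injective_projections; simpl; ring).
    ring.
  - rewrite RtoC_mult, Cmult_assoc. apply is_CInt_scal.
    apply (@RInt_correct R_CompleteNormedModule), regular_ex_RInt.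
    now apply regular_mult.
Qed.

(** * Regularity at the poles *)

(** A predicate on functions rather than a syntax with evaluation: [Derive_n] applies to members
    directly, and [auto] proves membership from the constructors. *)
Inductive polynomial : (R -> R) -> Prop :=
| polynomial_const c : polynomial (fun _ => c)
| polynomial_id : polynomial (fun x => x)
| polynomial_plus f g :
    polynomial f -> polynomial g -> polynomial (fun x => f x + g x)
| polynomial_mult f g :
    polynomial f -> polynomial g -> polynomial (fun x => f x * g x).

Lemma polynomial_ext f g : polynomial f -> (forall x, f x = g x) -> polynomial g.
Proof.
  intros hf h. now replace g with f by (apply functional_extensionality, h).
Qed.

Lemma polynomial_pow f n : polynomial f -> polynomial (fun x => f x ^ n).
Proof.
  intros hf. induction n; simpl; auto using polynomial.
Qed.

Lemma polynomial_minus f g :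
  polynomial f -> polynomial g -> polynomial (fun x => f x - g x).
Proof.
  intros hf hg. apply polynomial_ext with (fun x => f x + (-1) * g x).
  - auto using polynomial.
  - intro; ring.
Qed.

Lemma polynomial_is_derive f :
  polynomial f -> exists f', polynomial f' /\ forall x, is_derive f x (f' x).
Proof.
  induction 1 as [c| |f g _ [f' [pf hf]] _ [g' [pg hg]]|f g hpf [f' [pf hf]] hpg [g' [pg hg]]].
  - exists (fun _ => 0). split; [constructor|]. intro; apply @is_derive_const.
  - exists (fun _ => 1). split; [constructor|]. intro; apply @is_derive_id.
  - exists (fun x => f' x + g' x). split; auto using polynomial.
    intro; now apply @is_derive_plus.
  - exists (fun x => f' x * g x + f x * g' x). split; auto using polynomial.
    intro; apply @is_derive_mult; trivial. intros; apply Rmult_comm.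
Qed.

Lemma polynomial_ex_derive f x : polynomial f -> ex_derive f x.
Proof. intros h. destruct (polynomial_is_derive f h) as [f' [_ hf]]. now exists (f' x). Qed.

Lemma polynomial_Derive f : polynomial f -> polynomial (Derive f).
Proof.
  intros h. destruct (polynomial_is_derive f h) as [f' [pf hf]].
  apply polynomial_ext with (1 := pf). intro; symmetry; now apply is_derive_unique.
Qed.

Lemma polynomial_continuous f x : polynomial f -> continuous f x.
Proof.
  intros h. apply (@ex_derive_continuous R_AbsRing R_NormedModule).
  now apply polynomial_ex_derive.
Qed.

Lemma polynomial_one_minus_sq : polynomial (fun x => 1 - x ^ 2).
Proof. apply polynomial_minus; [constructor|]. apply polynomial_pow; constructor. Qed.

(** The derivative is kept as a multiple of the same power, at the price of a denominator: this
    avoids the exponent M - 1 and lets the square roots be factored out of every later formula. *)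
Lemma is_derive_sqrt_pow M x : -1 < x < 1 ->
  is_derive (fun y => sqrt (1 - y ^ 2) ^ M) x
    (sqrt (1 - x ^ 2) ^ M * (- (INR M * x / (1 - x ^ 2)))).
Proof.
  intros hx. assert (hs : 0 < 1 - x ^ 2) by nra.
  assert (hq := sqrt_lt_R0 _ hs). assert (hqq := sqrt_sqrt _ (Rlt_le _ _ hs)).
  induction M as [|M IH].
  - simpl INR. simpl pow.
    replace (1 * - (0 * x / (1 - x * (x * 1)))) with 0 by (unfold Rdiv; ring).
    apply @is_derive_const.
  - rewrite S_INR.
    apply (is_derive_ext (fun y => sqrt (1 - y ^ 2) * sqrt (1 - y ^ 2) ^ M)).
    { reflexivity. }
    replace (sqrt (1 - x ^ 2) ^ S M * - ((INR M + 1) * x / (1 - x ^ 2)))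
      with (- x / sqrt (1 - x ^ 2) * sqrt (1 - x ^ 2) ^ M + sqrt (1 - x ^ 2) *
        (sqrt (1 - x ^ 2) ^ M * (- (INR M * x / (1 - x ^ 2))))).
    + apply (@is_derive_mult R_AbsRing (fun y => sqrt (1 - y ^ 2))
        (fun y => sqrt (1 - y ^ 2) ^ M)); [|exact IH|intros; apply Rmult_comm].
      auto_derive; [lra|].
      replace (1 + - (x * (x * 1))) with (1 - x ^ 2) by ring. field. lra.
    + change (sqrt (1 - x ^ 2) ^ S M) with (sqrt (1 - x ^ 2) * sqrt (1 - x ^ 2) ^ M).
      set (q := sqrt (1 - x ^ 2)) in *. rewrite <- hqq. field. lra.
Qed.

Lemma is_derive_spherical M p q x :
  polynomial q -> (forall x, -1 < x < 1 -> p x = sqrt (1 - x ^ 2) ^ M * q x) ->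
  -1 < x < 1 ->
  is_derive p x (sqrt (1 - x ^ 2) ^ M * (Derive q x - INR M * x / (1 - x ^ 2) * q x)).
Proof.
  intros hq hp hx.
  apply (is_derive_ext_loc (fun x => sqrt (1 - x ^ 2) ^ M * q x)).
  { apply (locally_open_interval _ _ _ _ hx). intros; symmetry; auto. }
  replace (sqrt (1 - x ^ 2) ^ M * (Derive q x - INR M * x / (1 - x ^ 2) * q x))
    with (sqrt (1 - x ^ 2) ^ M * (- (INR M * x / (1 - x ^ 2))) * q x
          + sqrt (1 - x ^ 2) ^ M * Derive q x) by (unfold Rdiv; ring).
  apply (@is_derive_mult R_AbsRing (fun y => sqrt (1 - y ^ 2) ^ M) q).
  - now apply is_derive_sqrt_pow.
  - now apply Derive_correct, polynomial_ex_derive.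
  - intros; apply Rmult_comm.
Qed.

(* The radial profiles of smooth functions of longitudinal frequency +-M, up to
   replacing polynomials by smooth functions. *)
Definition spherical (M : nat) (p : R -> R) : Prop :=
  exists q, polynomial q /\ forall x, -1 < x < 1 -> p x = sqrt (1 - x ^ 2) ^ M * q x.

Lemma spherical_polynomial p : polynomial p -> spherical 0 p.
Proof. intros h. exists p. split; trivial. intros; simpl; ring. Qed.

Lemma spherical_regular M p : spherical M p -> regular p.
Proof.
  intros [q [hq hp]]. exists (fun x => sqrt (1 - x ^ 2) ^ M * q x). split; trivial.
  intro x. apply (@continuous_mult R_UniformSpace R_AbsRing).
  - assert (h : continuous (fun x => sqrt (1 - x ^ 2)) x).
    { apply (continuous_comp (fun x => 1 - x ^ 2) sqrt).
      - apply polynomial_continuous, polynomial_one_minus_sq.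
      - apply continuous_sqrt. }
    clear hp. induction M as [|M IH]; simpl.
    + apply continuous_const.
    + exact (@continuous_mult R_UniformSpace R_AbsRing (fun x => sqrt (1 - x ^ 2))
        (fun x => sqrt (1 - x ^ 2) ^ M) x h IH).
  - now apply polynomial_continuous.
Qed.

Lemma spherical_differentiable M p : spherical M p -> differentiable p.
Proof.
  intros [q [hq hp]] x hx. eexists. now apply is_derive_spherical with (1 := hq) (2 := hp).
Qed.

(** The factor 1 - x^2 cancels the pole of p', so the flux is spherical of the same order and can be
    differentiated again by the same rule. *)
Lemma spherical_flux M p q :
  polynomial q -> (forall x, -1 < x < 1 -> p x = sqrt (1 - x ^ 2) ^ M * q x) ->
  forall x, -1 < x < 1 -> (1 - x ^ 2) * Derive p x
    = sqrt (1 - x ^ 2) ^ M * ((1 - x ^ 2) * Derive q x - INR M * x * q x).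
Proof.
  intros hq hp x hx.
  rewrite (is_derive_unique _ _ _ (is_derive_spherical _ _ _ _ hq hp hx)).
  field. nra.
Qed.

Lemma polynomial_flux M q : polynomial q ->
  polynomial (fun x => (1 - x ^ 2) * Derive q x - INR M * x * q x).
Proof.
  intros hq. apply polynomial_minus; repeat apply polynomial_mult;
    auto using polynomial, polynomial_Derive, polynomial_one_minus_sq.
Qed.

Lemma spherical_differentiable_flux M p :
  spherical M p -> differentiable (fun x => (1 - x ^ 2) * Derive p x).
Proof.
  intros [q [hq hp]]. apply spherical_differentiable with M.
  eexists. split; [apply (polynomial_flux M), hq|]. now apply spherical_flux.
Qed.

Lemma abs_nat_sq (k : Z) : INR (Z.abs_nat k) ^ 2 = IZR k ^ 2.
Proof. rewrite INR_IZR_INZ, Zabs2Nat.id_abs, abs_IZR. apply pow2_abs. Qed.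

Lemma radial_Laplacian_eq M k p q :
  polynomial q -> (forall x, -1 < x < 1 -> p x = sqrt (1 - x ^ 2) ^ M * q x) ->
  INR M ^ 2 = IZR k ^ 2 ->
  forall x, -1 < x < 1 -> radial_Laplacian k p x
    = sqrt (1 - x ^ 2) ^ M *
      ((1 - x ^ 2) * Derive (Derive q) x - 2 * (INR M + 1) * x * Derive q x
       - INR M * (INR M + 1) * q x).
Proof.
  intros hq hp hk x hx. unfold radial_Laplacian.
  (* Differentiating the flux leaves the pole M^2 x^2 / (1 - x^2) q; since M^2 = k^2, subtracting
     k^2 / (1 - x^2) q turns it into -M^2 q. *)
  rewrite (is_derive_unique _ _ _ (is_derive_spherical _ _ _ _ (polynomial_flux M q hq)
     (spherical_flux M p q hq hp) hx)).
  rewrite <- hk, hp by trivial.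
  rewrite (is_derive_unique _ _ (- 2 * x * Derive q x + (1 - x ^ 2) * Derive (Derive q) x
     - INR M * (q x + x * Derive q x))).
  - field. nra.
  - auto_derive.
    + repeat split; trivial; apply polynomial_ex_derive; trivial; now apply polynomial_Derive.
    + simpl. change (fun x => Derive (fun y => q y) x) with (Derive q).
      change (fun x => q x) with q. change (fun x => Derive q x) with (Derive q). ring.
Qed.

Lemma spherical_radial_Laplacian M k p :
  INR M ^ 2 = IZR k ^ 2 -> spherical M p -> spherical M (radial_Laplacian k p).
Proof.
  intros hk [q [hq hp]]. eexists. split; [|exact (radial_Laplacian_eq M k p q hq hp hk)].
  apply polynomial_minus; [apply polynomial_minus|]; repeat apply polynomial_mult;
    auto using polynomial, polynomial_Derive, polynomial_one_minus_sq.
Qed.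

(* Differentiating the two square roots produces a pole
   [(k2 |k1| - k1 |k2|) / (1 - x^2)].  It vanishes unless k1 and k2 have opposite
   signs, and then |k1| + |k2| >= |k1 + k2| + 2 leaves a factor [1 - x^2] that
   cancels it. *)
Lemma spherical_wronskian k1 p1 k2 p2 :
  spherical (Z.abs_nat k1) p1 -> spherical (Z.abs_nat k2) p2 ->
  spherical (Z.abs_nat (k1 + k2)) (wronskian k1 p1 k2 p2).
Proof.
  intros [q1 [hq1 hp1]] [q2 [hq2 hp2]].
  assert (E : forall x, -1 < x < 1 -> wronskian k1 p1 k2 p2 x =
    sqrt (1 - x ^ 2) ^ (Z.abs_nat k1 + Z.abs_nat k2) *
    (IZR k1 * q1 x * Derive q2 x - IZR k2 * Derive q1 x * q2 x
     - IZR (k1 * Z.abs k2 - k2 * Z.abs k1) * (x * q1 x * q2 x) / (1 - x ^ 2))).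
  { intros x hx. unfold wronskian.
    rewrite (is_derive_unique _ _ _ (is_derive_spherical _ _ _ _ hq1 hp1 hx)).
    rewrite (is_derive_unique _ _ _ (is_derive_spherical _ _ _ _ hq2 hp2 hx)).
    rewrite hp1, hp2, pow_add, minus_IZR, !mult_IZR by trivial.
    rewrite !INR_IZR_INZ, !Zabs2Nat.id_abs. field. nra. }
  assert (P0 : polynomial (fun x => IZR k1 * q1 x * Derive q2 x - IZR k2 * Derive q1 x * q2 x)).
  { apply polynomial_minus; repeat apply polynomial_mult;
      auto using polynomial, polynomial_Derive. }
  assert (cases : (Z.abs_nat (k1 + k2) = Z.abs_nat k1 + Z.abs_nat k2)%nat /\
        (k1 * Z.abs k2 - k2 * Z.abs k1 = 0)%Z \/
    exists j, (Z.abs_nat k1 + Z.abs_nat k2 = Z.abs_nat (k1 + k2) + 2 * S j)%nat).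
  { destruct (Z_lt_le_dec 0 (k1 * k2)) as [h|h].
    - left. split; [nia|]. destruct (Z.abs_spec k1), (Z.abs_spec k2); nia.
    - destruct (Z.eq_dec (k1 * k2) 0) as [h0|h0].
      + left. apply Z.mul_eq_0 in h0. destruct h0; subst; split; try lia.
      + right. assert (k1 <> 0 /\ k2 <> 0)%Z by nia.
        (* For opposite signs, |k1| + |k2| exceeds |k1 + k2| by exactly twice the smaller absolute
           value, which is at least 1. *)
        exists (Nat.min (Z.abs_nat k1) (Z.abs_nat k2) - 1)%nat.
        assert (k1 < 0 < k2 \/ k2 < 0 < k1)%Z by nia. lia. }
  destruct cases as [[-> h]|[j hj]].
  - eexists; split; [exact P0|]. intros x hx. rewrite E, h by trivial.
    f_equal. unfold Rdiv. ring.
  - exists (fun x => (1 - x ^ 2) ^ S j *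
        (IZR k1 * q1 x * Derive q2 x - IZR k2 * Derive q1 x * q2 x)
      - (1 - x ^ 2) ^ j * (IZR (k1 * Z.abs k2 - k2 * Z.abs k1) * (x * q1 x * q2 x))).
    split.
    + apply polynomial_minus; apply polynomial_mult; trivial;
        try apply polynomial_pow, polynomial_one_minus_sq;
        repeat apply polynomial_mult; auto using polynomial.
    + intros x hx. rewrite E, hj, pow_add, pow_mult by trivial.
      assert (hs : 0 < 1 - x ^ 2) by nra.
      rewrite pow2_sqrt by lra. rewrite Rmult_assoc. f_equal.
      change ((1 - x ^ 2) ^ S j) with ((1 - x ^ 2) * (1 - x ^ 2) ^ j).
      generalize ((1 - x ^ 2) ^ j). intro. field. lra.
Qed.

(** * Stream functions *)

Lemma constant_of_derive_zero (f : R -> R) a b :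
  (forall x, a < x < b -> is_derive f x 0) ->
  forall x y, a < x < b -> a < y < b -> f x = f y.
Proof.
  intros h.
  assert (W : forall x y, a < x < b -> a < y < b -> x < y -> f x = f y).
  { intros x y hx hy hxy. apply (@eq_is_derive R_NormedModule); trivial.
    intros t ht. apply h. lra. }
  intros x y hx hy. destruct (Rtotal_order x y) as [?|[->|?]]; auto.
  symmetry; auto.
Qed.

(** [F] itself shows that a stream function exists, so the one chosen by [epsilon] has the defining
    property. *)
Lemma stream_spec F :
  differentiable_field F ->
  differentiable_field (stream (nabla_perp F)) /\
  eq_rect (d_lambda (stream (nabla_perp F))) (d_lambda F) /\
  eq_rect (d_mu (stream (nabla_perp F))) (d_mu F).
Proof.
  intros hF.
  assert (H : is_stream (nabla_perp F) (stream (nabla_perp F))).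
  { unfold stream. apply epsilon_spec. exists F. intros lam mu hl hm.
    destruct (hF lam mu hl hm). auto. }
  split; [|split].
  - intros lam mu hl hm. destruct (H lam mu hl hm) as [? [? _]]. auto.
  - intros lam mu hl hm. destruct (H lam mu hl hm) as [_ [_ h]].
    unfold nabla_perp in h at 1 2. injection h. congruence.
  - intros lam mu hl hm. destruct (H lam mu hl hm) as [_ [_ h]].
    unfold nabla_perp in h at 1 2. apply (f_equal fst) in h. cbn [fst] in h.
    assert (inj : forall z w : C, (- z = - w)%C -> z = w).
    { intros z w hzw. replace z with (- - z)%C by ring. rewrite hzw. ring. }
    symmetry. now apply inj.
Qed.

(** Encoded as a separated field of frequency 0, so that a stream function g + const is a sum of two
    separated fields and falls under the same inner product formulas. *)
Definition const_field (z : C) : scalar_field := sep z 0 (fun _ => 1).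

Lemma const_fieldE z lam mu : const_field z lam mu = z.
Proof.
  unfold const_field, sep, cis. rewrite Rmult_0_l, cos_0, sin_0.
  apply injective_projections; simpl; ring.
Qed.

Lemma eq_grad_const F G :
  differentiable_field F -> differentiable_field G ->
  eq_rect (d_lambda F) (d_lambda G) -> eq_rect (d_mu F) (d_mu G) ->
  exists z, eq_rect F (fadd G (const_field z)).
Proof.
  (* The difference is compared with its value at the base point (PI, 0), moving in longitude at
     fixed mu and then in mu along the meridian lambda = PI. *)
  intros hF hG hl hm. exists (F PI 0%R - G PI 0%R)%C.
  assert (B : 0 < PI < 2 * PI) by (generalize PI_RGT_0; lra).
  assert (K : forall (pr : C -> R) f g x, ex_derive (fun y => pr (f y)) x ->
     ex_derive (fun y => pr (g y)) x ->
     Derive (fun y => pr (f y)) x = Derive (fun y => pr (g y)) x ->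
     is_derive (fun y => pr (f y) - pr (g y)) x 0).
  { intros pr f g x h1 h2 h3.
    replace 0 with (Derive (fun y => pr (f y)) x - Derive (fun y => pr (g y)) x) by lra.
    apply @is_derive_minus; now apply Derive_correct. }
  assert (K' : forall pr, (pr = Re \/ pr = Im) -> forall lam mu,
     0 < lam < 2 * PI -> -1 < mu < 1 ->
     pr (F lam mu) - pr (G lam mu) = pr (F PI 0) - pr (G PI 0)).
  { intros pr hpr lam mu h1 h2.
    transitivity (pr (F PI mu) - pr (G PI mu)).
    - apply (constant_of_derive_zero (fun lam => pr (F lam mu) - pr (G lam mu)) 0 (2 * PI));
        trivial.
      intros x hx. destruct (hF x mu hx h2) as [[? ?] _], (hG x mu hx h2) as [[? ?] _].
      specialize (hl x mu hx h2). unfold d_lambda, CDerive in hl. injection hl as e1 e2.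
      apply (K pr (fun x => F x mu) (fun x => G x mu)); destruct hpr; subst; trivial.
    - apply (constant_of_derive_zero (fun mu => pr (F PI mu) - pr (G PI mu)) (-1) 1);
        trivial; [|lra].
      intros x hx. destruct (hF PI x B hx) as [_ [? ?]], (hG PI x B hx) as [_ [? ?]].
      specialize (hm PI x B hx). unfold d_mu, CDerive in hm. injection hm as e1 e2.
      apply (K pr (fun x => F PI x) (fun x => G PI x)); destruct hpr; subst; trivial. }
  intros lam mu h1 h2. unfold fadd. rewrite const_fieldE.
  generalize (K' Re (or_introl eq_refl) lam mu h1 h2).
  generalize (K' Im (or_intror eq_refl) lam mu h1 h2).
  unfold Re, Im. intros k1 k2.
  apply injective_projections; simpl; lra.
Qed.

(** Every occurrence of a stream function in [MC] is differentiated, so the chosen stream functions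
    may be replaced by [F] and [G]. *)
Lemma MC_nabla_perp F G :
  differentiable_field F -> differentiable_field G ->
  forall v w, is_inner (Laplacian (bracket F G)) (bracket F G) v ->
  is_inner (bracket (Laplacian F) G) (bracket F G) w ->
  MC (nabla_perp F) (nabla_perp G) = (v - w)%C.
Proof.
  intros hF hG v w hv hw.
  destruct (stream_spec F hF) as [hF' [f1 f2]].
  destruct (stream_spec G hG) as [hG' [g1 g2]].
  unfold MC. f_equal; [|f_equal]; apply is_inner_unique.
  - apply is_inner_ext with (3 := hv).
    + now apply Laplacian_ext, bracket_ext_grad.
    + now apply bracket_ext_grad.
  - apply is_inner_ext with (3 := hw).
    + apply bracket_ext_grad; trivial.
      * now apply d_lambda_ext, Laplacian_ext_grad.
      * now apply d_mu_ext, Laplacian_ext_grad.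
    + now apply bracket_ext_grad.
Qed.

(** * Associated Legendre functions *)

Lemma polynomial_Derive_n f n : polynomial f -> polynomial (Derive_n f n).
Proof. intros h. induction n; simpl; trivial. now apply polynomial_Derive. Qed.

Lemma is_derive_Derive_n_polynomial f n x :
  polynomial f -> is_derive (Derive_n f n) x (Derive_n f (S n) x).
Proof.
  intros h. simpl. apply Derive_correct, polynomial_ex_derive.
  now apply polynomial_Derive_n.
Qed.

Lemma polynomial_RInt_Derive f a b :
  polynomial f -> RInt (Derive f) a b = f b - f a.
Proof.
  intros h. apply RInt_Derive.
  - intros; now apply polynomial_ex_derive.
  - intros; now apply polynomial_continuous, polynomial_Derive.
Qed.

Lemma polynomial_ex_RInt f a b : polynomial f -> ex_RInt f a b.
Proof.
  intros h. apply (@ex_RInt_continuous R_CompleteNormedModule).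
  intros; now apply polynomial_continuous.
Qed.

Lemma polynomial_RInt_lincomb c d f g a b :
  polynomial f -> polynomial g ->
  RInt (fun x => c * f x - d * g x) a b = c * RInt f a b - d * RInt g a b.
Proof.
  intros hf hg. apply is_RInt_unique.
  apply (@is_RInt_minus R_NormedModule); apply (@is_RInt_scal R_NormedModule),
    (@RInt_correct R_CompleteNormedModule); now apply polynomial_ex_RInt.
Qed.

Lemma is_derive_of_zero f x l : (forall y, f y = 0) -> is_derive f x l -> l = 0.
Proof.
  intros h hd. apply is_derive_unique in hd. rewrite <- hd.
  rewrite (Derive_ext f (fun _ => 0) x h). apply Derive_const.
Qed.

(** * Derivatives of powers of x^2 - 1 *)

Definition rodrigues (l : nat) : R -> R := fun x => (x ^ 2 - 1) ^ l.

Lemma polynomial_rodrigues l : polynomial (rodrigues l).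
Proof.
  apply (polynomial_pow (fun x => x ^ 2 - 1)), polynomial_minus; [|constructor].
  apply polynomial_pow; constructor.
Qed.

(** The function f = (x^2 - 1)^l satisfies (1 - x^2) f' + 2 l x f = 0, and this is its derivative of
    order n + 1. The last coefficient is the sum of 2l - 2j over j = 0, ..., n. *)
Lemma rodrigues_ode l n x :
  (1 - x ^ 2) * Derive_n (rodrigues l) (S (S n)) x
  + (2 * INR l - 2 * (INR n + 1)) * x * Derive_n (rodrigues l) (S n) x
  + (INR n + 1) * (2 * INR l - INR n) * Derive_n (rodrigues l) n x = 0.
Proof.
  assert (d := fun n x => is_derive_Derive_n_polynomial _ n x (polynomial_rodrigues l)).
  (* One differentiation lowers the coefficient of the middle term by 2 and adds its old value to
     the last one; [b] stands for the last term. *)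
  assert (step : forall n a b,
    (forall x, (1 - x ^ 2) * Derive_n (rodrigues l) (S n) x
       + a * x * Derive_n (rodrigues l) n x + b x = 0) ->
    forall x b', is_derive b x b' ->
     (1 - x ^ 2) * Derive_n (rodrigues l) (S (S n)) x
       + (a - 2) * x * Derive_n (rodrigues l) (S n) x
       + a * Derive_n (rodrigues l) n x + b' = 0).
  { clear n x. intros n a b H x b' hb.
    apply (is_derive_of_zero _ x _ H).
    assert (h0 := d n x). assert (h1 := d (S n) x).
    set (g0 := Derive_n (rodrigues l) n) in *.
    set (g1 := Derive_n (rodrigues l) (S n)) in *.
    set (v := Derive_n (rodrigues l) (S (S n)) x) in *.
    auto_derive.
    - repeat split; eexists; eassumption.
    - change (fun x => g1 x) with g1. change (fun x => g0 x) with g0.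
      change (fun x => b x) with b.
      rewrite (is_derive_unique g1 _ _ h1), (is_derive_unique g0 _ _ h0),
        (is_derive_unique b _ _ hb). simpl. ring. }
  revert x. induction n as [|n IH]; intro x.
  - assert (H : forall x, (1 - x ^ 2) * Derive_n (rodrigues l) 1 x
       + 2 * INR l * x * Derive_n (rodrigues l) 0 x + 0 = 0).
    { clear x. intro x. change (Derive_n (rodrigues l) 1) with (Derive (rodrigues l)).
      simpl Derive_n.
      rewrite (is_derive_unique (rodrigues l) x (INR l * (2 * x) * (x ^ 2 - 1) ^ pred l)).
      - unfold rodrigues. destruct l as [|l]; simpl pred; [simpl; ring|].
        change ((x ^ 2 - 1) ^ S l) with ((x ^ 2 - 1) * (x ^ 2 - 1) ^ l). ring.
      - unfold rodrigues. auto_derive; trivial.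
        replace (x * (x * 1) + - (1)) with (x ^ 2 - 1) by ring. ring. }
    assert (E := step 0%nat (2 * INR l) (fun _ => 0) H x 0 (@is_derive_const R_AbsRing R_NormedModule 0 x)).
    rewrite <- E. simpl INR. ring.
  - assert (E := step (S n) _ _ IH x _ (is_derive_scal _ x
      ((INR n + 1) * (2 * INR l - INR n)) _ (d n x))).
    rewrite <- E, S_INR. ring.
Qed.

(** Leibniz' rule, which stops after three terms because x^2 - 1 is quadratic. Starting at order n +
    2 keeps all the orders free of subtraction. *)
Lemma Derive_n_sq_minus_one_mult f n x : polynomial f ->
  Derive_n (fun x => (x ^ 2 - 1) * f x) (S (S n)) x
  = (x ^ 2 - 1) * Derive_n f (S (S n)) x + 2 * (INR n + 2) * x * Derive_n f (S n) x
    + (INR n + 2) * (INR n + 1) * Derive_n f n x.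
Proof.
  intros hf. revert x.
  assert (d := fun n x => is_derive_Derive_n_polynomial f n x hf).
  assert (D : forall a b g0 g1 g2 g0' g1' g2' x, is_derive g0 x g0' ->
    is_derive g1 x g1' -> is_derive g2 x g2' ->
    Derive (fun x => (x ^ 2 - 1) * g2 x + a * x * g1 x + b * g0 x) x
    = (x ^ 2 - 1) * g2' + 2 * x * g2 x + a * x * g1' + a * g1 x + b * g0').
  { intros a b g0 g1 g2 g0' g1' g2' x h0 h1 h2. apply is_derive_unique.
    auto_derive.
    - repeat split; eexists; eassumption.
    - change (fun x => g1 x) with g1. change (fun x => g0 x) with g0.
      change (fun x => g2 x) with g2.
      rewrite (is_derive_unique g1 _ _ h1), (is_derive_unique g0 _ _ h0),
        (is_derive_unique g2 _ _ h2). simpl. ring. }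
  assert (z : forall x, is_derive (fun _ : R => 0) x 0)
    by (intro; apply @is_derive_const).
  induction n as [|n IH]; intro x.
  (* The two initial derivatives also go through [D], with zero functions standing in for the
     derivatives of negative order. *)
  - change (Derive (fun y => Derive (fun z => (z ^ 2 - 1) * f z) y) x
      = (x ^ 2 - 1) * Derive_n f 2 x + 2 * (0 + 2) * x * Derive_n f 1 x
        + (0 + 2) * (0 + 1) * f x).
    rewrite (Derive_ext _ (fun x => (x ^ 2 - 1) * Derive_n f 1 x + 2 * x * f x + 0 * 0)).
    + rewrite (D _ _ (fun _ => 0) f (Derive_n f 1) _ _ _ x (z x) (d 0%nat x) (d 1%nat x)).
      ring.
    + intro y. rewrite (Derive_ext _ (fun x => (x ^ 2 - 1) * f x + 0 * x * 0 + 0 * 0))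
        by (intro; ring).
      rewrite (D _ _ (fun _ => 0) (fun _ => 0) f _ _ _ y (z y) (z y) (d 0%nat y)). ring.
  - change (Derive (Derive_n (fun x => (x ^ 2 - 1) * f x) (S (S n))) x
      = (x ^ 2 - 1) * Derive_n f (S (S (S n))) x
        + 2 * (INR (S n) + 2) * x * Derive_n f (S (S n)) x
        + (INR (S n) + 2) * (INR (S n) + 1) * Derive_n f (S n) x).
    rewrite (Derive_ext _ _ x IH).
    rewrite (D _ _ _ _ _ _ _ _ x (d n x) (d (S n) x) (d (S (S n)) x)).
    rewrite S_INR. ring.
Qed.

(** (x^2 - 1)^l is monic of degree 2l. In the induction, Leibniz' rule has two terms of order above
    2l, which vanish; the third brings the factor (2l + 2)(2l + 1). *)
Lemma rodrigues_top l x : Derive_n (rodrigues l) (2 * l) x = INR (fact (2 * l)).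
Proof.
  revert x. induction l as [|l IH]; intro x.
  - reflexivity.
  - replace (2 * S l)%nat with (S (S (2 * l))) by lia.
    rewrite (Derive_n_ext (rodrigues (S l)) (fun x => (x ^ 2 - 1) * rodrigues l x))
      by (intro; reflexivity).
    rewrite Derive_n_sq_minus_one_mult by apply polynomial_rodrigues.
    assert (h1 : forall x, Derive_n (rodrigues l) (S (2 * l)) x = 0).
    { intro y. change (Derive (Derive_n (rodrigues l) (2 * l)) y = 0).
      rewrite (Derive_ext _ _ y IH). apply Derive_const. }
    assert (h2 : Derive_n (rodrigues l) (S (S (2 * l))) x = 0).
    { change (Derive (Derive_n (rodrigues l) (S (2 * l))) x = 0).
      rewrite (Derive_ext _ _ x h1). apply Derive_const. }
    rewrite h1, h2, IH.
    rewrite (fact_simpl (S (2 * l))), (fact_simpl (2 * l)).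
    rewrite (mult_INR (S (S (2 * l)))), (mult_INR (S (2 * l))), !S_INR. ring.
Qed.

(** The L^2 product of two associated Legendre functions of order m without their constants 2^l l!;
    the two square root factors are merged so that the integrand is a polynomial. *)
Definition weighted_product (m l l' : nat) : R :=
  RInt (fun x => (1 - x ^ 2) ^ m * Derive_n (rodrigues l) (l + m) x
                 * Derive_n (rodrigues l') (l' + m) x) (-1) 1.

Lemma polynomial_weighted m l l' : polynomial
  (fun x => (1 - x ^ 2) ^ m * Derive_n (rodrigues l) (l + m) x
                 * Derive_n (rodrigues l') (l' + m) x).
Proof.
  repeat apply polynomial_mult; auto using polynomial_Derive_n, polynomial_rodrigues.
  apply polynomial_pow, polynomial_one_minus_sq.
Qed.

(* Self-adjointness of the Legendre operator
   [u |-> ((1 - x^2)^(m+1) u')' / (1 - x^2)^m], of eigenvalue [(m-l)(l+m+1)] at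
   [Derive_n (rodrigues l) (l + m)]; the boundary terms vanish. *)
Lemma weighted_product_S m l l' :
  weighted_product (S m) l l'
  = (INR l + INR m + 1) * (INR l - INR m) * weighted_product m l l'.
Proof.
  unfold weighted_product.
  set (u := Derive_n (rodrigues l) (l + m)). set (v := Derive_n (rodrigues l') (l' + m)).
  set (F := fun x => (1 - x ^ 2) ^ S m * Derive_n (rodrigues l) (l + S m) x * v x).
  assert (pF : polynomial F).
  { unfold F, v. apply polynomial_mult; [apply polynomial_mult|];
      auto using polynomial_Derive_n, polynomial_rodrigues.
    apply (polynomial_pow _ (S m)), polynomial_one_minus_sq. }
  assert (I : RInt (Derive F) (-1) 1 = 0).
  { rewrite polynomial_RInt_Derive by trivial. unfold F. simpl. ring. }
  set (c := (INR l + INR m + 1) * (INR l - INR m)).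
  assert (E : forall x, Derive F x = 1 * ((1 - x ^ 2) ^ S m * Derive_n (rodrigues l) (l + S m) x
       * Derive_n (rodrigues l') (l' + S m) x) - c * ((1 - x ^ 2) ^ m * u x * v x)).
  { intro x.
    unfold F. rewrite !Nat.add_succ_r.
    assert (hv := is_derive_Derive_n_polynomial _ (l' + m) x (polynomial_rodrigues l')).
    assert (hu := is_derive_Derive_n_polynomial _ (S (l + m)) x (polynomial_rodrigues l)).
    assert (ode := rodrigues_ode l (l + m) x).
    fold v in hv. fold u in ode.
    set (u1 := Derive_n (rodrigues l) (S (l + m))) in *.
    set (u2 := Derive_n (rodrigues l) (S (S (l + m))) x) in *.
    set (v1 := Derive_n (rodrigues l') (S (l' + m)) x) in *.
    apply is_derive_unique. auto_derive.
    - repeat split; eexists; eassumption.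
    - change (fun x => v x) with v. change (fun x => u1 x) with u1.
      rewrite (is_derive_unique v _ _ hv), (is_derive_unique u1 _ _ hu).
      replace (1 + - (x * (x * 1))) with (1 - x ^ 2) by ring.
      change (match m with 0%nat => 1 | S _ => INR m + 1 end) with (INR (S m)).
      rewrite S_INR.
      change ((1 - x ^ 2) ^ S m) with ((1 - x ^ 2) * (1 - x ^ 2) ^ m).
      simpl pred.
      rewrite plus_INR in ode.
      assert (E : c * u x = - ((1 - x ^ 2) * u2 - 2 * (INR m + 1) * x * u1 x)).
      { unfold c. apply Rminus_diag_uniq. rewrite <- ode. ring. }
      generalize ((1 - x ^ 2) ^ m). intro s.
      replace (c * (s * u x * v x)) with (s * v x * (c * u x)) by ring.
      rewrite E. ring. }
  rewrite (RInt_ext _ _ _ _ (fun x _ => E x)) in I.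
  rewrite (polynomial_RInt_lincomb 1 c _ _ _ _ (polynomial_weighted (S m) l l')
    (polynomial_weighted m l l')) in I.
  unfold u, v. lra.
Qed.

Lemma weighted_product_sym m l l' : weighted_product m l l' = weighted_product m l' l.
Proof.
  unfold weighted_product. f_equal. apply functional_extensionality. intro; ring.
Qed.

(** The product of order m + 1 is symmetric in l and l', so the eigenvalue factors for l and l' must
    give the same result; they differ by (l - l')(l + l' + 1). *)
Lemma weighted_product_orthogonal m l l' : l <> l' -> weighted_product m l l' = 0.
Proof.
  intros h.
  assert (E := weighted_product_S m l l'). assert (E' := weighted_product_S m l' l).
  rewrite weighted_product_sym, E, (weighted_product_sym m l' l) in E'.
  assert (D : (INR l - INR l') * (INR l + INR l' + 1) * weighted_product m l l' = 0).
  { apply Rminus_diag_eq in E'. rewrite <- E'. ring. }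
  apply not_INR in h. assert (0 <= INR l) by apply pos_INR. assert (0 <= INR l') by apply pos_INR.
  apply Rmult_integral in D. destruct D as [D|]; trivial.
  apply Rmult_integral in D. destruct D; lra.
Qed.

Lemma RInt_one_minus_sq_pow l :
  INR (fact (2 * l + 1)) * RInt (fun x => (1 - x ^ 2) ^ l) (-1) 1
  = 2 * 4 ^ l * INR (fact l) ^ 2.
Proof.
  induction l as [|l IH].
  - rewrite (RInt_ext _ (fun _ => 1)) by (intros; reflexivity).
    rewrite RInt_const. unfold scal; simpl; unfold mult; simpl. ring.
  - set (K := RInt (fun x => (1 - x ^ 2) ^ l) (-1) 1) in *.
    assert (E : (2 * INR l + 3) * RInt (fun x => (1 - x ^ 2) ^ S l) (-1) 1 = 2 * (INR l + 1) * K).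
    { assert (P := fun l => polynomial_pow _ l polynomial_one_minus_sq).
      (* Integration by parts: x (1 - x^2)^(l+1) vanishes at both ends, and writing x^2 as 1 - (1 -
         x^2) in its derivative gives the recursion [E]. *)
      assert (I := polynomial_RInt_Derive (fun x => x * (1 - x ^ 2) ^ S l) (-1) 1
        (polynomial_mult _ _ polynomial_id (P (S l)))).
      rewrite (RInt_ext _ (fun x => (2 * INR l + 3) * (1 - x ^ 2) ^ S l
         - 2 * (INR l + 1) * (1 - x ^ 2) ^ l)) in I.
      - rewrite (polynomial_RInt_lincomb _ _ _ _ _ _ (P (S l)) (P l)) in I.
        fold K in I. simpl in I |- *. lra.
      - intros x _. apply is_derive_unique. auto_derive; trivial.
        replace (1 + - (x * (x * 1))) with (1 - x ^ 2) by ring.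
        change (match l with 0%nat => 1 | S _ => INR l + 1 end) with (INR (S l)).
        rewrite S_INR. change ((1 - x ^ 2) ^ S l) with ((1 - x ^ 2) * (1 - x ^ 2) ^ l).
        simpl pred. ring. }
    replace (2 * S l + 1)%nat with (S (S (2 * l + 1))) by lia.
    rewrite 2!fact_simpl, !mult_INR, !S_INR, plus_INR, mult_INR. simpl (INR 1). simpl (INR 2).
    rewrite (fact_simpl l), mult_INR, S_INR.
    transitivity ((2 * INR l + 2) * INR (fact (2 * l + 1)) *
      ((2 * INR l + 3) * RInt (fun x => (1 - x ^ 2) ^ S l) (-1) 1)); [ring|].
    rewrite E.
    transitivity ((2 * INR l + 2) * (2 * (INR l + 1)) * (INR (fact (2 * l + 1)) * K)); [ring|].
    rewrite IH. simpl pow. ring.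
Qed.

(** Descends from m = l, where the derivative of order 2l is the constant (2l)! and only the
    integral of (1 - x^2)^l remains; each step down uses [weighted_product_S]. *)
Lemma weighted_product_norm m l j : (l = m + j)%nat ->
  (2 * INR l + 1) * INR (fact (l - m)) * weighted_product m l l
  = INR (fact (l + m)) * (2 * 4 ^ l * INR (fact l) ^ 2).
Proof.
  revert m. induction j as [|j IH]; intros m h.
  - replace m with l by lia. rewrite Nat.sub_diag, <- RInt_one_minus_sq_pow.
    unfold weighted_product.
    rewrite (RInt_ext _ (fun x => scal (INR (fact (l + l)) ^ 2) ((1 - x ^ 2) ^ l))).
    + rewrite (RInt_scal (V := R_CompleteNormedModule)).
      * unfold scal; simpl; unfold mult; simpl.
        replace (l + (l + 0) + 1)%nat with (S (l + l)) by lia.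
        rewrite fact_simpl, mult_INR, S_INR, plus_INR. ring.
      * apply polynomial_ex_RInt, polynomial_pow, polynomial_one_minus_sq.
    + intros x _. replace (l + l)%nat with (2 * l)%nat by lia.
      rewrite rodrigues_top. unfold scal; simpl; unfold mult; simpl. ring.
  - assert (E := IH (S m) ltac:(lia)).
    rewrite weighted_product_S in E.
    replace (l + S m)%nat with (S (l + m)) in E by lia.
    replace (l - m)%nat with (S (l - S m)) by lia.
    rewrite fact_simpl, mult_INR in E |- *.
    assert (hl : INR l = INR m + INR (S j)) by (rewrite h; apply plus_INR).
    replace (INR (S (l - S m))) with (INR l - INR m).
    2: { rewrite hl. replace (l - S m)%nat with j by lia. ring. }
    rewrite S_INR, plus_INR in E.
    assert (p1 : 0 <= INR l) by apply pos_INR. assert (p2 : 0 <= INR m) by apply pos_INR.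
    apply Rmult_eq_reg_l with (INR l + INR m + 1); [|lra].
    eapply eq_trans; [|eapply eq_trans; [exact E|]]; ring.
Qed.

(** * Associated Legendre functions and normalization *)

Definition legendre_radial (l m : nat) : R -> R :=
  fun x => sqrt (1 - x ^ 2) ^ m * Derive_n (rodrigues l) (l + m) x.

Lemma spherical_legendre l m : spherical m (legendre_radial l m).
Proof.
  eexists; split; [|reflexivity]. apply polynomial_Derive_n, polynomial_rodrigues.
Qed.

(** This is [rodrigues_ode] at n = l + m: there the last coefficient is (l + m + 1)(l - m) = l(l+1)
    - m(m+1), and the term m(m+1) cancels against the one from [radial_Laplacian_eq]. *)
Lemma radial_Laplacian_legendre l k x : -1 < x < 1 ->
  radial_Laplacian k (legendre_radial l (Z.abs_nat k)) x
  = - (INR l * (INR l + 1)) * legendre_radial l (Z.abs_nat k) x.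
Proof.
  intros hx. set (m := Z.abs_nat k).
  rewrite (radial_Laplacian_eq m k _ (Derive_n (rodrigues l) (l + m))); trivial.
  - assert (ode := rodrigues_ode l (l + m) x). rewrite plus_INR in ode.
    change (Derive_n (rodrigues l) (S (S (l + m)))) with
      (Derive (Derive (Derive_n (rodrigues l) (l + m)))) in ode.
    change (Derive_n (rodrigues l) (S (l + m))) with
      (Derive (Derive_n (rodrigues l) (l + m))) in ode.
    unfold legendre_radial.
    replace (- (INR l * (INR l + 1)) * (sqrt (1 - x ^ 2) ^ m * Derive_n (rodrigues l) (l + m) x))
      with (sqrt (1 - x ^ 2) ^ m * (- (INR l * (INR l + 1)) * Derive_n (rodrigues l) (l + m) x))
      by ring.
    f_equal. apply Rminus_diag_uniq. rewrite <- ode. ring.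
  - apply polynomial_Derive_n, polynomial_rodrigues.
  - apply abs_nat_sq.
Qed.

Lemma RInt_legendre_radial l l' m :
  RInt (fun x => legendre_radial l m x * legendre_radial l' m x) (-1) 1
  = weighted_product m l l'.
Proof.
  apply RInt_ext. intros x. rewrite Rmin_left, Rmax_right by lra. intros hx.
  unfold legendre_radial. match goal with |- ?a = ?b => change (@eq R a b) end.
  transitivity (sqrt (1 - x ^ 2) ^ m * sqrt (1 - x ^ 2) ^ m *
    (Derive_n (rodrigues l) (l + m) x * Derive_n (rodrigues l') (l' + m) x)); [ring|].
  rewrite <- Rpow_mult_distr, sqrt_sqrt by nra. ring.
Qed.

(** Gathers all the constants of [Y], including the factor 1 / (2^l l!) left out of
    [legendre_radial]. For negative m two signs appear, one from the reflection and one from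
    [Y_nonneg]. *)
Definition Y_coef (l : nat) (m : Z) : R :=
  let k := Z.abs_nat m in
  (if Z.leb 0 m then 1 else (-1) ^ k)
  * ((-1) ^ k * sqrt ((2 * INR l + 1) / (4 * PI)
                      * (INR (fact (l - k)) / INR (fact (l + k))))
     / (2 ^ l * INR (fact l))).

Lemma Y_sep l m : Y l m = sep (RtoC (Y_coef l m)) m (legendre_radial l (Z.abs_nat m)).
Proof.
  apply functional_extensionality; intro lam.
  apply functional_extensionality; intro mu.
  unfold Y, Y_coef. destruct (Z.leb_spec 0 m) as [h|h].
  - rewrite <- Zabs2Nat.abs_nat_nonneg by trivial.
    unfold Y_nonneg, sep, Legendre, legendre_radial, rodrigues.
    rewrite (INR_IZR_INZ (Z.abs_nat m)), Zabs2Nat.id_abs, Z.abs_eq, <- RtoC_mult by trivial.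
    f_equal. f_equal. unfold Rdiv. ring.
  - unfold Y_nonneg, sep, Legendre, legendre_radial, rodrigues.
    replace (IZR m * lam) with (- (INR (Z.abs_nat m) * lam)).
    2: { rewrite INR_IZR_INZ, Zabs2Nat.id_abs, Z.abs_neq, opp_IZR by lia. ring. }
    unfold cis. rewrite cos_neg, sin_neg.
    apply injective_projections; simpl; unfold Rdiv; ring.
Qed.

(** The unit norm of Y_lm, with 2 PI from the longitude integral. The bound on m makes the natural
    number subtraction l - k a true difference. *)
Lemma Y_coef_norm l m : (Z.abs m <= Z.of_nat l)%Z ->
  Y_coef l m ^ 2 * (2 * PI) *
  RInt (fun x => legendre_radial l (Z.abs_nat m) x * legendre_radial l (Z.abs_nat m) x) (-1) 1
  = 1.
Proof.
  intros h. rewrite RInt_legendre_radial. unfold Y_coef.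
  set (k := Z.abs_nat m). assert (hk : (k <= l)%nat) by lia.
  assert (N := weighted_product_norm k l (l - k) ltac:(lia)).
  assert (f1 := INR_fact_lt_0 (l - k)). assert (f2 := INR_fact_lt_0 (l + k)).
  assert (f3 := INR_fact_lt_0 l). assert (pl := pos_INR l). assert (hpi := PI_RGT_0).
  set (q := (2 * INR l + 1) / (4 * PI) * (INR (fact (l - k)) / INR (fact (l + k)))).
  assert (hq : 0 <= q).
  { unfold q. apply Rmult_le_pos; apply Rlt_le, Rdiv_lt_0_compat; lra. }
  assert (sg : ((-1) ^ k) ^ 2 = 1).
  { rewrite <- pow_mult, Nat.mul_comm, pow_mult. replace ((-1) ^ 2) with 1 by ring. apply pow1. }
  assert (s2 : (if Z.leb 0 m then 1 else (-1) ^ k) ^ 2 = 1) by (destruct (Z.leb 0 m); [ring|trivial]).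
  unfold Rdiv. rewrite !Rpow_mult_distr, s2, sg, pow2_sqrt by trivial.
  assert (p2 : 0 < 2 ^ l) by (apply pow_lt; lra).
  assert (p4 : 4 ^ l = 2 ^ l * 2 ^ l) by (rewrite <- Rpow_mult_distr; f_equal; ring).
  rewrite p4 in N.
  assert (J : weighted_product k l l = INR (fact (l + k)) * (2 * (2 ^ l * 2 ^ l) * INR (fact l) ^ 2)
     / ((2 * INR l + 1) * INR (fact (l - k)))).
  { rewrite <- N. field. lra. }
  rewrite J. unfold q. field. repeat split; lra.
Qed.

(** * The Misiolek criteria of a wave *)

Lemma eq_rect_sep z w k j p q : z = w -> k = j ->
  (forall x, -1 < x < 1 -> p x = q x) -> eq_rect (sep z k p) (sep w j q).
Proof. intros -> -> h lam mu hl hm. unfold sep. now rewrite h. Qed.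

Lemma eq_rect_sep_scal r z w k j p q : (w = z * RtoC r)%C -> k = j ->
  (forall x, -1 < x < 1 -> p x = r * q x) -> eq_rect (sep z k p) (sep w j q).
Proof.
  intros -> -> h lam mu hl hm. unfold sep. rewrite h, RtoC_mult by trivial. ring.
Qed.

Lemma eq_rect_fadd F F' G G' :
  eq_rect F F' -> eq_rect G G' -> eq_rect (fadd F G) (fadd F' G').
Proof. intros h1 h2 lam mu hl hm. unfold fadd. now rewrite h1, h2. Qed.

Lemma spherical_id : spherical 0 (fun x => x).
Proof. apply spherical_polynomial. constructor. Qed.

Lemma spherical_one : spherical 0 (fun _ => 1).
Proof. apply spherical_polynomial. constructor. Qed.

Lemma radial_Laplacian_id x : radial_Laplacian 0 (fun y => y) x = - 2 * x.
Proof.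
  unfold radial_Laplacian.
  rewrite (Derive_ext _ (fun y => 1 - y ^ 2)).
  - rewrite (is_derive_unique _ _ (- 2 * x)).
    + unfold Rdiv; ring.
    + auto_derive; trivial. ring.
  - intro y. rewrite Derive_id. ring.
Qed.

Lemma wronskian_id k p x : wronskian 0 (fun y => y) k p x = - IZR k * p x.
Proof. unfold wronskian. rewrite Derive_id. ring. Qed.

(** The bracket with mu is minus the longitude derivative, hence the factor -i k at frequency k. *)
Lemma bracket_mu_sep z w k p :
  eq_rect (bracket (sep w 0 (fun x => x)) (sep z k p)) (sep (- Ci * RtoC (IZR k) * w * z)%C k p).
Proof.
  rewrite bracket_sep. apply eq_rect_sep_scal with (- IZR k).
  - rewrite RtoC_opp. ring.
  - trivial.
  - intros x _. apply wronskian_id.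
Qed.

Lemma mu_field_sep : mu_field = sep 1 0 (fun x => x).
Proof.
  apply functional_extensionality; intro lam.
  apply functional_extensionality; intro mu.
  unfold mu_field, sep, cis. rewrite Rmult_0_l, cos_0, sin_0.
  apply injective_projections; simpl; ring.
Qed.

Lemma bracket_mu_fadd_sep z1 k1 p1 z2 k2 p2 :
  differentiable p1 -> differentiable p2 ->
  eq_rect (bracket mu_field (fadd (sep z1 k1 p1) (sep z2 k2 p2)))
    (fadd (sep (- Ci * RtoC (IZR k1) * z1)%C k1 p1)
          (sep (- Ci * RtoC (IZR k2) * z2)%C k2 p2)).
Proof.
  intros h1 h2. rewrite mu_field_sep.
  eapply eq_rect_trans; [apply bracket_fadd_r; now apply differentiable_sep|].
  apply eq_rect_fadd; (eapply eq_rect_trans; [apply bracket_mu_sep|]);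
    apply eq_rect_sep; trivial; ring.
Qed.

(** A common form for the Rossby-Haurwitz wave, its Laplacian, and a single spherical harmonic, for
    which c = 0. *)
Definition wave (a : C) (k : Z) (p : R -> R) (c : C) : scalar_field :=
  fadd (sep a k p) (sep c 0 (fun x => x)).

Lemma bracket_wave a k1 p1 c z2 k2 p2 : differentiable p1 ->
  eq_rect (bracket (wave a k1 p1 c) (sep z2 k2 p2))
    (fadd (sep (Ci * a * z2)%C (k1 + k2) (wronskian k1 p1 k2 p2))
          (sep (- Ci * RtoC (IZR k2) * c * z2)%C k2 p2)).
Proof.
  intros h1. unfold wave.
  eapply eq_rect_trans; [apply bracket_fadd_l; apply differentiable_sep; trivial|].
  - apply (spherical_differentiable 0), spherical_id.
  - apply eq_rect_fadd; [rewrite bracket_sep; now apply eq_rect_sep|apply bracket_mu_sep].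
Qed.

Lemma differentiable_wave a k p c :
  differentiable p -> differentiable_field (wave a k p c).
Proof.
  intros h. apply differentiable_fadd; apply differentiable_sep; trivial.
  apply (spherical_differentiable 0), spherical_id.
Qed.

Lemma is_inner_fadd_sep u1 j1 r1 u2 j2 r2 v1 i1 s1 v2 i2 s2 :
  regular r1 -> regular r2 -> regular s1 -> regular s2 ->
  is_inner (fadd (sep u1 j1 r1) (sep u2 j2 r2)) (fadd (sep v1 i1 s1) (sep v2 i2 s2))
   (u1 * Cconj v1 * RtoC (circle_integral (j1 - i1) * RInt (fun x => r1 x * s1 x)%R (-1) 1)
    + u2 * Cconj v1 * RtoC (circle_integral (j2 - i1) * RInt (fun x => r2 x * s1 x)%R (-1) 1)
    + (u1 * Cconj v2 * RtoC (circle_integral (j1 - i2) * RInt (fun x => r1 x * s2 x)%R (-1) 1)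
      + u2 * Cconj v2 * RtoC (circle_integral (j2 - i2) * RInt (fun x => r2 x * s2 x)%R (-1) 1)))%C.
Proof.
  intros. apply is_inner_fadd_r; apply is_inner_fadd_l; now apply is_inner_sep.
Qed.

Lemma circle_integral_neq n : n <> 0%Z -> circle_integral n = 0.
Proof. intros h. unfold circle_integral. destruct (Z.eqb_spec n 0); [contradiction|reflexivity]. Qed.

(** A longitude derivative has mean zero; this is what removes the additive constant of the stream
    function from the Coriolis term. *)
Lemma freq_circle_integral n : IZR n * circle_integral n = 0.
Proof.
  unfold circle_integral. destruct (Z.eqb_spec n 0) as [->|_]; ring.
Qed.

Lemma Cconj_RtoC (r : R) : Cconj (RtoC r) = RtoC r.
Proof. apply injective_projections; simpl; ring. Qed.

Lemma Cconj_Ci : Cconj Ci = (- Ci)%C.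
Proof. apply injective_projections; simpl; ring. Qed.

Lemma Ci_sq : (Ci * Ci)%C = RtoC (-1).
Proof. apply injective_projections; simpl; ring. Qed.

Lemma Cmod_sq_conj z : RtoC (Cmod z ^ 2) = (z * Cconj z)%C.
Proof.
  unfold Cmod. rewrite pow2_sqrt by nra. apply injective_projections; simpl; ring.
Qed.

Section Misiolek.

Variables (k1 k2 : Z) (p1 p2 : R -> R) (L1 L2 z2 : R).
Hypothesis k1_neq0 : k1 <> 0%Z.
Hypothesis sph1 : spherical (Z.abs_nat k1) p1.
Hypothesis sph2 : spherical (Z.abs_nat k2) p2.
Hypothesis eigen1 : forall x, -1 < x < 1 -> radial_Laplacian k1 p1 x = - L1 * p1 x.
Hypothesis eigen2 : forall x, -1 < x < 1 -> radial_Laplacian k2 p2 x = - L2 * p2 x.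
Hypothesis norm2 : z2 ^ 2 * (2 * PI) * RInt (fun x => p2 x * p2 x) (-1) 1 = 1.

Let b : R -> R := wronskian k1 p1 k2 p2.
Let g : scalar_field := sep (RtoC z2) k2 p2.

Let sph_b : spherical (Z.abs_nat (k1 + k2)) b.
Proof. now apply spherical_wronskian. Qed.

(** The contribution of frequency k1 + k2 for unit amplitude. The sign of [L1] combines the minus in
    the criterion with the eigenvalue -L1 of [p1]. *)
Definition wave_energy : R :=
  z2 ^ 2 * (2 * PI) * (RInt (fun x => radial_Laplacian (k1 + k2) b x * b x) (-1) 1
                       + L1 * RInt (fun x => b x * b x) (-1) 1).

Lemma MC_wave (a : C) (c : R) :
  MC (nabla_perp (wave a k1 p1 (RtoC (- c)))) (nabla_perp g)
  = (a * Cconj a * RtoC wave_energy + RtoC (c ^ 2 * IZR k2 ^ 2 * (2 - L2)))%C.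
Proof.
  assert (d1 := spherical_differentiable _ _ sph1).
  assert (d2 := spherical_differentiable _ _ sph2).
  assert (db := spherical_differentiable _ _ sph_b).
  assert (f1 := spherical_differentiable_flux _ _ sph1).
  assert (f2 := spherical_differentiable_flux _ _ sph2).
  assert (fb := spherical_differentiable_flux _ _ sph_b).
  assert (rb := spherical_regular _ _ sph_b).
  assert (r2 := spherical_regular _ _ sph2).
  assert (rL : regular (radial_Laplacian (k1 + k2) b))
    by (eapply spherical_regular, spherical_radial_Laplacian, sph_b; apply abs_nat_sq).
  set (S := fadd (sep (Ci * a * RtoC z2) (k1 + k2) b)
                 (sep (Ci * RtoC (IZR k2 * c * z2)) k2 p2)%C).
  assert (ES : eq_rect (bracket (wave a k1 p1 (RtoC (- c))) g) S).
  { eapply eq_rect_trans; [now apply bracket_wave|].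
    apply eq_rect_fadd; apply eq_rect_sep; trivial.
    rewrite !RtoC_mult, RtoC_opp. ring. }
  assert (ELS : eq_rect (Laplacian (bracket (wave a k1 p1 (RtoC (- c))) g))
    (fadd (sep (Ci * a * RtoC z2) (k1 + k2) (radial_Laplacian (k1 + k2) b))
          (sep (Ci * RtoC (- L2 * (IZR k2 * c * z2))) k2 p2))%C).
  { eapply eq_rect_trans; [apply Laplacian_ext, ES|].
    eapply eq_rect_trans; [now apply Laplacian_fadd_sep|].
    apply eq_rect_fadd; [now apply eq_rect_sep|].
    apply eq_rect_sep_scal with (- L2); trivial. rewrite !RtoC_mult. ring. }
  assert (ELf : eq_rect (Laplacian (wave a k1 p1 (RtoC (- c))))
    (wave (a * RtoC (- L1)) k1 p1 (RtoC (2 * c)))).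
  { eapply eq_rect_trans; [apply Laplacian_fadd_sep; trivial;
      [apply (spherical_differentiable 0)|apply (spherical_differentiable_flux 0)];
      apply spherical_id|].
    apply eq_rect_fadd.
    - now apply eq_rect_sep_scal with (- L1).
    - apply eq_rect_sep_scal with (- 2); trivial.
      + rewrite <- RtoC_mult. f_equal. ring.
      + intros x _. apply radial_Laplacian_id. }
  (* The zonal coefficient passes from -c to 2c, so the second component is -2 times that of [S]. *)
  assert (EB : eq_rect (bracket (Laplacian (wave a k1 p1 (RtoC (- c)))) g)
    (fadd (sep (Ci * (a * RtoC (- L1)) * RtoC z2) (k1 + k2) b)
          (sep (Ci * RtoC (- (2 * (IZR k2 * c * z2)))) k2 p2))%C).
  { eapply eq_rect_trans; [apply bracket_ext; [exact ELf|intros ? ? ? ?; reflexivity]|].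
    eapply eq_rect_trans; [now apply bracket_wave|].
    apply eq_rect_fadd; apply eq_rect_sep; trivial.
    rewrite RtoC_opp, !RtoC_mult. ring. }
  erewrite MC_nabla_perp; cycle 1.
  - now apply differentiable_wave.
  - now apply differentiable_sep.
  - eapply is_inner_ext; [exact ELS|exact ES|]. now apply is_inner_fadd_sep.
  - eapply is_inner_ext; [exact EB|exact ES|]. now apply is_inner_fadd_sep.
  (* The mixed terms carry the frequencies k1 and -k1, which are nonzero. *)
  - rewrite !Z.sub_diag, (circle_integral_neq (k1 + k2 - k2)),
      (circle_integral_neq (k2 - (k1 + k2))) by lia.
    unfold circle_integral; simpl Z.eqb; cbv iota.
    rewrite !Cmult_conj, !Cconj_Ci, !Cconj_RtoC.
    (* Multiplying by the norm of [g], which is 1, makes both sides polynomial in the three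
       remaining integrals. *)
    assert (I : RtoC (IZR k2 ^ 2 * c ^ 2 * (2 - L2)) =
      (RtoC (IZR k2 ^ 2 * c ^ 2 * (2 - L2) *
        (z2 ^ 2 * (2 * PI) * RInt (fun x => p2 x * p2 x)%R (-1) 1)))%C)
      by (rewrite norm2; f_equal; ring).
    replace (c ^ 2 * IZR k2 ^ 2 * (2 - L2)) with (IZR k2 ^ 2 * c ^ 2 * (2 - L2)) by ring.
    rewrite I. unfold wave_energy.
    generalize (RInt (fun x => p2 x * p2 x)%R (-1) 1).
    generalize (RInt (fun x => b x * b x)%R (-1) 1).
    generalize (RInt (fun x => radial_Laplacian (k1 + k2) b x * b x)%R (-1) 1).
    intros I1 I2 I3. apply injective_projections; simpl; ring.
Qed.

Lemma stream_wave_bracket_mu (a : C) (c : R) :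
  inner (bracket mu_field (stream (nabla_perp (wave a k1 p1 (RtoC (- c))))))
        (stream (nabla_perp g))
  = (- Ci * RtoC (IZR k1) * a
     * RtoC (z2 * circle_integral (k1 - k2) * RInt (fun x => p1 x * p2 x)%R (-1) 1))%C.
Proof.
  assert (d1 := spherical_differentiable _ _ sph1).
  assert (d2 := spherical_differentiable _ _ sph2).
  destruct (stream_spec (wave a k1 p1 (RtoC (- c)))) as [df [ef1 ef2]];
    [now apply differentiable_wave|].
  destruct (stream_spec g) as [dg [eg1 eg2]]; [now apply differentiable_sep|].
  destruct (eq_grad_const _ _ dg (differentiable_sep _ _ _ d2) eg1 eg2) as [z hz].
  apply is_inner_unique.
  eapply is_inner_ext with (2 := hz).
  { eapply eq_rect_trans; [apply bracket_ext_grad; [| |exact ef1|exact ef2];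
      intros ? ? ? ?; reflexivity|].
    apply bracket_mu_fadd_sep; trivial.
    apply (spherical_differentiable 0), spherical_id. }
  (* The four-term value is found by unification and simplified afterwards: the zonal component has
     coefficient k = 0, and the constant [z] meets only the nonzero frequency k1. *)
  match goal with |- is_inner _ _ ?v => evar (w : C); replace v with w; unfold w end.
  - unfold const_field. apply is_inner_fadd_sep;
      eauto using spherical_regular, spherical_id, spherical_one.
  - rewrite (circle_integral_neq (k1 - 0)) by lia. rewrite Cconj_RtoC.
    rewrite !RtoC_mult. ring.
Qed.

Lemma stream_wave_coriolis (a : C) (c : R) :
  inner (bracket mu_field (bracket (stream (nabla_perp (wave a k1 p1 (RtoC (- c)))))
                                   (stream (nabla_perp g))))
        (stream (nabla_perp g))
  = RtoC (IZR k2 ^ 2 * c).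
Proof.
  assert (d1 := spherical_differentiable _ _ sph1).
  assert (d2 := spherical_differentiable _ _ sph2).
  assert (db := spherical_differentiable _ _ sph_b).
  destruct (stream_spec (wave a k1 p1 (RtoC (- c)))) as [df [ef1 ef2]];
    [now apply differentiable_wave|].
  destruct (stream_spec g) as [dg [eg1 eg2]]; [now apply differentiable_sep|].
  destruct (eq_grad_const _ _ dg (differentiable_sep _ _ _ d2) eg1 eg2) as [z hz].
  apply is_inner_unique.
  eapply is_inner_ext with (2 := hz).
  { eapply eq_rect_trans.
    - apply bracket_ext; [intros ? ? ? ?; reflexivity|].
      eapply eq_rect_trans; [apply bracket_ext_grad; [exact ef1|exact ef2|exact eg1|exact eg2]|].
      now apply bracket_wave.
    - now apply bracket_mu_fadd_sep. }
  match goal with |- is_inner _ _ ?v => evar (w : C); replace v with w; unfold w end.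
  - unfold const_field. apply is_inner_fadd_sep;
      eauto using spherical_regular, spherical_id, spherical_one.
  - rewrite (circle_integral_neq (k1 + k2 - k2)) by lia.
    rewrite !Z.sub_0_r, Z.sub_diag, Rmult_0_l. fold b.
    assert (h1 := freq_circle_integral (k1 + k2)). assert (h2 := freq_circle_integral k2).
    apply (f_equal RtoC) in h1, h2. rewrite RtoC_mult in h1, h2.
    rewrite Cconj_RtoC, !(RtoC_mult (circle_integral _)).
    assert (I : RtoC (IZR k2 ^ 2 * c) =
      (RtoC (IZR k2 ^ 2 * c * (z2 ^ 2 * (2 * PI) * RInt (fun x => p2 x * p2 x)%R (-1) 1)))%C)
      by (rewrite norm2; f_equal; ring).
    rewrite I.
    generalize (RInt (fun x => p2 x * p2 x)%R (-1) 1).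
    generalize (RInt (fun x => b x * p2 x)%R (-1) 1).
    generalize (RInt (fun x => b x * 1)%R (-1) 1).
    generalize (RInt (fun x => p2 x * 1)%R (-1) 1).
    intros I1 I2 I3 I4.
    set (K1 := RtoC (IZR (k1 + k2))) in *. set (K2 := RtoC (IZR k2)) in *.
    set (O1 := RtoC (circle_integral (k1 + k2))) in *.
    set (O2 := RtoC (circle_integral k2)) in *.
    (* The terms containing the constant [z] are grouped as frequency times circle integral, which
       is zero; only the product of the Y_(l2,m2) component with [g] survives. *)
    transitivity (- Ci * Ci * a * RtoC z2 * Cconj z * RtoC I2 * (K1 * O1)
      + Ci * Ci * K2 * RtoC (- c) * RtoC z2 * Cconj z * RtoC I1 * (K2 * O2)
      + (Ci * Ci) * K2 * K2 * RtoC (- c) * RtoC z2 * RtoC z2 * RtoC (circle_integral 0) * RtoC I4)%C.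
    + ring.
    + rewrite h1, h2, Ci_sq. unfold K2. change (circle_integral 0) with (2 * PI).
      rewrite !RtoC_mult, !RtoC_pow, !RtoC_opp. simpl Cpow. rewrite ?RtoC_opp. ring.
Qed.

End Misiolek.

(** Translation in longitude multiplies a pure frequency by a phase, which is absorbed in the
    amplitude. *)
Lemma RH_wave_sep A c omega l m t :
  RH_wave A c omega l m t
  = wave (A * RtoC (Y_coef l m) * cis (- (IZR m * (omega * t)))) m
      (legendre_radial l (Z.abs_nat m)) (RtoC (- c)).
Proof.
  apply functional_extensionality; intro lam.
  apply functional_extensionality; intro mu.
  unfold RH_wave, wave, fadd. rewrite Y_sep. unfold sep.
  replace (IZR m * (lam - omega * t)) with (- (IZR m * (omega * t)) + IZR m * lam) by ring.
  rewrite cis_plus. unfold cis at 5. rewrite Rmult_0_l, cos_0, sin_0.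
  change (1, 0) with (RtoC 1). rewrite RtoC_opp, RtoC_mult. ring.
Qed.

(** Written with [- 0] to match the shape of [MC_wave], which then also evaluates the criterion for
    [e l1 m1]. *)
Lemma Y_wave l m : Y l m
  = wave (RtoC (Y_coef l m)) m (legendre_radial l (Z.abs_nat m)) (RtoC (- 0)).
Proof.
  rewrite Y_sep.
  apply functional_extensionality; intro lam.
  apply functional_extensionality; intro mu.
  unfold wave, fadd, sep. rewrite Ropp_0. ring.
Qed.

Lemma cis_conj x : (cis x * Cconj (cis x))%C = RtoC 1.
Proof.
  assert (h := sin2_cos2 x). unfold Rsqr in h.
  apply injective_projections; simpl; [rewrite <- h|]; ring.
Qed.

Theorem proposition4p3
  (A : C) (c omega : R) (l1 : nat) (m1 : Z)
  (hl1 : (1 <= l1)%nat) (hm1 : m1 <> 0%Z)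
  (hlm1 : (Z.abs m1 <= Z.of_nat l1)%Z)
  (t : R) (l2 : nat) (m2 : Z)
  (hl2 : (1 <= l2)%nat) (hlm2 : (Z.abs m2 <= Z.of_nat l2)%Z) :
  MC (nabla_perp (RH_wave A c omega l1 m1 t)) (e l2 m2)
  = (RtoC (Cmod A ^ 2) * MC (e l1 m1) (e l2 m2)
     + RtoC (c ^ 2 * IZR m2 ^ 2 * (2 - INR l2 * (INR l2 + 1))))%C
  /\
  (forall a b : R,
    MC_hat (nabla_perp (RH_wave A c omega l1 m1 t), a) (e l2 m2, b)
    = (RtoC (Cmod A ^ 2) * MC (e l1 m1) (e l2 m2)
       + RtoC (c ^ 2 * IZR m2 ^ 2 * (2 - INR l2 * (INR l2 + 1)))
       - RtoC (Cmod A ^ 2 * IZR m1 ^ 2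
               * delta (Z.of_nat l1) (Z.of_nat l2) * delta m1 m2)
       - RtoC (a * IZR m2 ^ 2 * c))%C).
Proof.
  unfold e. rewrite RH_wave_sep, (Y_wave l1 m1), (Y_sep l2 m2).
  set (a1 := (A * RtoC (Y_coef l1 m1) * cis (- (IZR m1 * (omega * t))))%C).
  assert (ha : (a1 * Cconj a1)%C = RtoC (Cmod A ^ 2 * Y_coef l1 m1 ^ 2)).
  { rewrite RtoC_mult, Cmod_sq_conj. unfold a1. rewrite !Cmult_conj, Cconj_RtoC.
    transitivity (A * Cconj A * (RtoC (Y_coef l1 m1) * RtoC (Y_coef l1 m1))
      * (cis (- (IZR m1 * (omega * t))) * Cconj (cis (- (IZR m1 * (omega * t))))))%C; [ring|].
    rewrite cis_conj, RtoC_pow. simpl Cpow. ring. }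
  assert (s1 := spherical_legendre l1 (Z.abs_nat m1)).
  assert (s2 := spherical_legendre l2 (Z.abs_nat m2)).
  assert (e1 := radial_Laplacian_legendre l1 m1).
  assert (e2 := radial_Laplacian_legendre l2 m2).
  assert (n2 := Y_coef_norm l2 m2 hlm2).
  assert (MC1 : MC (nabla_perp (wave a1 m1 (legendre_radial l1 (Z.abs_nat m1)) (RtoC (- c))))
     (nabla_perp (sep (RtoC (Y_coef l2 m2)) m2 (legendre_radial l2 (Z.abs_nat m2))))
   = (RtoC (Cmod A ^ 2) * MC (nabla_perp (wave (RtoC (Y_coef l1 m1)) m1
         (legendre_radial l1 (Z.abs_nat m1)) (RtoC (- 0))))
     (nabla_perp (sep (RtoC (Y_coef l2 m2)) m2 (legendre_radial l2 (Z.abs_nat m2))))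
     + RtoC (c ^ 2 * IZR m2 ^ 2 * (2 - INR l2 * (INR l2 + 1))))%C).
  { rewrite !(MC_wave _ _ _ _ _ _ _ hm1 s1 s2 e1 e2 n2), ha, Cconj_RtoC.
    rewrite RtoC_mult, !RtoC_pow. simpl Cpow.
    replace (0 ^ 2 * IZR m2 ^ 2 * (2 - INR l2 * (INR l2 + 1))) with 0 by ring. ring. }
  split; [exact MC1|].
  intros a b. unfold MC_hat. rewrite MC1.
  rewrite (stream_wave_bracket_mu _ _ _ _ _ hm1 s1 s2).
  rewrite (stream_wave_coriolis _ _ _ _ _ hm1 s1 s2 n2).
  apply (f_equal2 Cminus); [apply (f_equal2 Cminus); [reflexivity|]|].
  2: { rewrite <- RtoC_mult. f_equal. ring. }
  rewrite Cmod_sq_conj, !Cmult_conj, !Cconj_RtoC, Copp_conj, Cconj_Ci.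
  (* Together with one factor [Y_coef l1 m1], [J] is the inner product of the two harmonics. The
     circle integral decides the delta in m, and orthogonality of Legendre functions the delta in
     l. *)
  set (J := _ * circle_integral _ * _).
  transitivity (- (Ci * Ci) * (a1 * Cconj a1) * RtoC (IZR m1) * RtoC (IZR m1) * RtoC J * RtoC J)%C;
    [ring|].
  rewrite ha, Ci_sq, <- RtoC_opp, <- !RtoC_mult. f_equal.
  unfold delta, J, circle_integral.
  destruct (Z.eqb_spec (m1 - m2) 0) as [hm|hm], (Z.eqb_spec m1 m2) as [hm'|hm']; try lia.
  - subst m2. rewrite RInt_legendre_radial.
    destruct (Z.eqb_spec (Z.of_nat l1) (Z.of_nat l2)) as [hl|hl].
    + apply Nat2Z.inj in hl. subst l2. rewrite RInt_legendre_radial in n2.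
      (* For equal indices the inner product is the squared norm of one harmonic, so [n2] applies to
         the squared factor. *)
      transitivity (Cmod A ^ 2 * IZR m1 ^ 2 * (Y_coef l1 m1 ^ 2 * (2 * PI) *
         weighted_product (Z.abs_nat m1) l1 l1) ^ 2); [ring|].
      rewrite n2. ring.
    + rewrite weighted_product_orthogonal by congruence. ring.
  - ring.
Qed.
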